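(* Let $0<\alpha<1$, let $k\ge 1$ be an integer, let $\lambda_1,\dots,\lambda_k>0$, and let $\{M^{\alpha}(t)\}_{t\ge0}$ be the generalized fractional counting process (GFCP) with these parameters. For any fixed $h>0$, the increment process $\{Z^{\alpha}_{h}(t)\}_{t\ge0}$ defined by $$Z^{\alpha}_{h}(t)= M^{\alpha}(t+h)-M^{\alpha}(t),\quad t\geq0,$$ has the short-range dependence (SRD) property.
   Context: The generalized fractional counting process (GFCP) is $M^\alpha(t)=M(Y_\alpha(t))$, $t\ge0$, $0<\alpha<1$, where: $\{M(t)\}_{t\ge0}$ (the generalized counting process) is the compound Poisson process with jumps of sizes $1,\dots,k$ occurring at rates $\lambda_1,\dots,\lambda_k$ respectively, i.e. the Lévy process $M(t)=\sum_{i=1}^{N(t)}X_i$ with $\{N(t)\}_{t\ge0}$ a Poisson process of intensity $\Lambda=\lambda_1+\dots+\lambda_k$ independent of the iid sequence $\{X_i\}_{i\ge1}$, $\mathrm{Pr}\{X_1=j\}=\lambda_j/\Lambda$, $j=1,\dots,k$; and $\{Y_\alpha(t)\}_{t\ge0}$ is the inverse $\alpha$-stable subordinator, independent of $\{M(t)\}_{t\ge0}$: $Y_\alpha(t)=\inf\{x>0: D_\alpha(x)>t\}$, with $\{D_\alpha(t)\}_{t\ge0}$ the non-decreasing Lévy process satisfying $\mathbb{E}(e^{-sD_\alpha(t)})=e^{-ts^\alpha}$, $s>0$. Definition (LRD/SRD). Suppose a stochastic process $\{X(t)\}_{t\ge0}$ is such that, for fixed $s>0$ (arbitrary), its correlation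 function satisfies $$\operatorname{Corr}(X(s),X(t))\sim c(s)t^{-\theta}\quad\text{as } t\to\infty$$ for some $c(s)>0$, with $\theta$ not depending on $s$. The process is said to exhibit the long-range dependence (LRD) property if $\theta\in(0,1)$ and the SRD property if $\theta\in(1,2)$. Here $f(t)\sim g(t)$ means $f(t)/g(t)\to1$. *)

(* Defs.v *)
From HB Require Import structures.
From mathcomp Require Import all_boot all_order all_algebra finmap.
From mathcomp Require Import all_classical all_reals all_analysis.

Set Implicit Arguments.
Unset Strict Implicit.
Unset Printing Implicit Defensive.

Import Order.TTheory GRing.Theory Num.Theory.
Import numFieldNormedType.Exports.

Local Open Scope classical_set_scope.
Local Open Scope ring_scope.

(* A process {X(t)}_{t >= 0} is a function [X : R -> T -> U]; its values at
   negative times are never constrained nor used. *)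

Section independence.
Context (R : realType) (d : measure_display) (T : measurableType d).
Variable P : probability T R.

Definition mutually_independent (d' : measure_display) (U : measurableType d')
    (X : nat -> T -> U) : Prop :=
  forall (J : {fset nat}) (B : nat -> set U),
    (forall i, measurable (B i)) ->
    P (\bigcap_(i in [set` J]) (X i @^-1` B i)) =
      (\prod_(i <- J) P (X i @^-1` B i))%E.

(* sigma-algebra on T generated by the family (X i), for i in D *)
Definition generated_by (I : Type) (D : set I) (d' : measure_display)
    (U : measurableType d') (X : I -> T -> U) : set (set T) :=
  <<s \bigcup_(i in D) preimage_set_system setT (X i) measurable >>.

Definition independent_systems (F G : set (set T)) : Prop :=
  forall A B, F A -> G B -> P (A `&` B) = (P A * P B)%E.

End independence.

Definition nonneg_times (R : realType) : set R := [set t : R | 0 <= t].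

Section processes.
Context (R : realType) (d : measure_display) (T : measurableType d).
Variable P : probability T R.

Definition cadlag (f : R -> R) : Prop :=
  forall t : R, 0 <= t ->
    f x @[x --> t^'+] --> f t /\ (0 < t -> cvg (f x @[x --> t^'-])).

(* Every path is required to be cadlag, so that the time-changed process and
   the inverse of a subordinator below consist of genuine random variables
   although P need not be complete.  Stochastic continuity follows from
   right-continuity and stationarity of the increments. *)
Record levy_process (X : R -> T -> R) : Prop := LevyProcess {
  levy_measurable : forall t : R, 0 <= t -> measurable_fun [set: T] (X t) ;
  levy_start : {ae P, forall w, X 0 w = 0} ;
  levy_independent : forall t : nat -> R,
    0 <= t 0%N -> {homo t : m n / (m <= n)%N >-> m <= n} ->
    mutually_independent P (fun i w => X (t i.+1) w - X (t i) w) ;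
  levy_stationary : forall (s t : R) (B : set R),
    0 <= s -> 0 <= t -> measurable B ->
    P ((fun w => X (s + t) w - X s w) @^-1` B) = P (X t @^-1` B) ;
  levy_cadlag : forall w, cadlag (X ^~ w) }.

(* At t = 0 the law is given by [levy_start]; [poisson_pmf] is the Poisson
   mass function only for a positive rate. *)
Record poisson_process (mu : R) (N : R -> T -> nat) : Prop := PoissonProcess {
  poisson_levy : levy_process (fun t w => (N t w)%:R) ;
  poisson_law : forall (t : R) (n : nat), 0 < t ->
    P (N t @^-1` [set n]) = (poisson_pmf (mu * t) n)%:E }.

(* The index j : 'I_k, which ranges over 0, ..., k - 1, stands for the jump
   size j + 1. *)
Record jump_sizes (k : nat) (lam : 'I_k -> R) (X : nat -> T -> nat) : Prop :=
  JumpSizes {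
  jump_measurable : forall i, measurable_fun [set: T] (X i) ;
  jump_independent : mutually_independent P X ;
  jump_law : forall (i : nat) (j : 'I_k),
    P (X i @^-1` [set j.+1]) = (lam j / \sum_(l < k) lam l)%:E }.

(* generalized counting process: compound Poisson process with jumps of sizes
   1, ..., k at rates lam *)
Definition generalized_counting_process (k : nat) (lam : 'I_k -> R)
    (M : R -> T -> nat) : Prop :=
  exists (N : R -> T -> nat) (X : nat -> T -> nat),
    [/\ poisson_process (\sum_(j < k) lam j) N,
        jump_sizes lam X,
        independent_systems P (generated_by (@nonneg_times R) N)
                              (generated_by [set: nat] X) &
        forall (t : R) w, 0 <= t -> M t w = (\sum_(i < N t w) X i w)%N].

Record stable_subordinator (alpha : R) (D : R -> T -> R) : Prop :=
  StableSubordinator {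
  stable_levy : levy_process D ;
  stable_nondecreasing : {ae P, forall w,
    forall s t : R, 0 <= s -> s <= t -> D s w <= D t w} ;
  stable_laplace : forall s t : R, 0 < s -> 0 <= t ->
    ('E_P[fun w => expR (- s * D t w)] = (expR (- t * s `^ alpha))%:E)%E }.

(* [inf] is 0 on the empty set; a stable subordinator is almost surely
   unbounded, so that the set below is almost surely nonempty. *)
Definition inverse_stable_subordinator (alpha : R) (Y : R -> T -> R) : Prop :=
  exists2 D : R -> T -> R, stable_subordinator alpha D &
    forall (t : R) w, 0 <= t -> Y t w = inf [set x : R | 0 < x /\ t < D x w].

(* generalized fractional counting process *)
Definition gfcp (alpha : R) (k : nat) (lam : 'I_k -> R)
    (Malpha : R -> T -> nat) : Prop :=
  exists (M : R -> T -> nat) (Y : R -> T -> R),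
    [/\ generalized_counting_process lam M,
        inverse_stable_subordinator alpha Y,
        independent_systems P (generated_by (@nonneg_times R) M)
                              (generated_by (@nonneg_times R) Y) &
        forall (t : R) w, 0 <= t -> Malpha t w = M (Y t w) w].

Definition correlation (X Y : T -> R) : R :=
  fine (covariance P X Y) /
  (Num.sqrt (fine (variance P X)) * Num.sqrt (fine (variance P Y))).

Definition asymptotic_to (f g : R -> R) : Prop :=
  f t / g t @[t --> +oo] --> (1 : R).

Definition correlation_decay (X : R -> T -> R) (theta : R) : Prop :=
  forall s : R, 0 < s -> exists2 c : R, 0 < c &
    asymptotic_to (fun t => correlation (X s) (X t))
                  (fun t => c * t `^ (- theta)).

Definition short_range_dependent (X : R -> T -> R) : Prop :=
  exists2 theta : R, 1 < theta < 2 & correlation_decay X theta.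

End processes.

(* The subtraction takes place in R, not in nat. *)
Definition increment_process (R : realType) (T : Type) (M : R -> T -> nat)
    (h t : R) (w : T) : R := (M (t + h) w)%:R - (M t w)%:R.

(* Main.v *)
Require Import Defs.
From HB Require Import structures.
From mathcomp Require Import all_boot all_order all_algebra finmap.
From mathcomp Require Import all_classical all_reals all_analysis.
From mathcomp Require Import measurable_realfun.
From mathcomp Require Import zify ring lra.

Set Implicit Arguments.
Unset Strict Implicit.
Unset Printing Implicit Defensive.

Import Order.TTheory GRing.Theory Num.Theory.
Import numFieldNormedType.Exports.

Local Open Scope classical_set_scope.
Local Open Scope ring_scope.

(** Write Y for the inverse stable subordinator, dY_t = Y_(t+h) - Y_t, and m1,
    m2 for the rates at which the counting process M accumulates jumps and
    squared jumps.  As M has stationary independent increments and is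
    independent of Y, conditioning on Y gives, for s <= t,
      Cov(Malpha_s, Malpha_t) = m2 E Y_s + m1^2 Cov(Y_s, Y_t)
    ([gfcp_covariance]).  By bilinearity, for disjoint increments the m2 terms
    cancel: with Z the increment process,
      Cov(Z_s, Z_t) = m1^2 Cov(dY_s, dY_t)   if s + h <= t,
      Var Z_t = m2 E dY_t + m1^2 Var dY_t.

    The first two moments of Y come from the potential measure U of the
    subordinator D, U(A) = E int_0^oo 1_A(D_x) dx.  Its Laplace transform is
    int_0^oo exp(- x s^alpha) dx = s^(- alpha), which forces
    U ]-oo, t] = C t^alpha for some C > 0 ([laplace_power_law]).  Along a path,
    Y_b - Y_a is the time that D spends in ]a, b]; products of increments of Y
    are therefore double integrals over pairs (D_x, D_(x+z)), whose mean is an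
    integral against U twice because D has stationary independent increments:
      E (Y_b - Y_a) = U ]a, b],
      E (Y_b - Y_a)(Y_e - Y_c) = int_]a, b] U ]c - u, e - u] U(du)  (b <= c),
      E (Y_b - Y_a)^2 / 2 = int U {v | a < u, u + v <= b} U(du).
    Put g(t) = C t^alpha.  Then Cov(dY_s, dY_t) is the integral over ]s, s + h]
    of (g(t + h - u) - g(t - u)) - (g(t + h) - g(t)) with respect to U(du), a
    second difference of order t^(alpha - 2); while E dY_t and E dY_t^2 are
    first differences of g, of order t^(alpha - 1), which makes (E dY_t)^2
    negligible.  Mean value bounds for these differences squeeze each quantity
    between two shifted powers with the same positive constant, so that
      Cov(Z_s, Z_t) ~ G(s) t^(alpha - 2),   Var Z_t ~ V t^(alpha - 1),
    and the correlation is equivalent to c(s) t^(- theta) with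
    theta = (2 - alpha) - (1 - alpha) / 2 = (3 - alpha) / 2, a number strictly
    between 1 and 3/2. *)

(** * Evaluating a process at a random time *)
Section measurable_nat_valued.
Context d (T : measurableType d).

(** The final segments of the integers generate the discrete sigma-algebra. *)
Lemma measurable_fun_natP (f : T -> nat) :
  (forall n, measurable [set w | (n <= f w)%N]) -> measurable_fun setT f.
Proof.
move=> mf _ B _; rewrite setTI.
have -> : f @^-1` B = \bigcup_(n in B)
    ([set w | (n <= f w)%N] `\` [set w | (n.+1 <= f w)%N]).
  apply/seteqP; split=> [w Bw|w [n Bn] []]/=.
    by exists (f w) => //=; split; rewrite /= ?ltnn ?leqnn.
  by move=> nf /negP; rewrite -leqNgt => fn; suff -> : f w = n by []; lia.
by apply: bigcup_measurable => n _; exact: measurableD.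
Qed.

Lemma measurable_of_natr (R : realType) (f : T -> nat) :
  measurable_fun setT (fun w => (f w)%:R : R) -> measurable_fun setT f.
Proof.
move=> mf; apply: measurable_fun_natP => n.
have -> : [set w | (n <= f w)%N] = [set w | n%:R <= (f w)%:R :> R].
  by apply/seteqP; split => w /=; rewrite ler_nat.
by rewrite -[X in measurable X]setTI; exact: measurable_fun_ler.
Qed.

Lemma measurable_nat_index d' (V : measurableType d') (f : T -> nat)
    (F : nat -> T -> V) :
  measurable_fun setT f -> (forall n, measurable_fun setT (F n)) ->
  measurable_fun setT (fun w => F (f w) w).
Proof.
move=> mf mF _ B mB; rewrite setTI.
have -> : (fun w => F (f w) w) @^-1` B = \bigcup_n
    ((f @^-1` [set n]) `&` (F n @^-1` B)).
  apply/seteqP; split=> [w Bw|w [n _] [/= <-]]//=.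
  by exists (f w).
apply: bigcupT_measurable => n; apply: measurableI.
  by rewrite -[X in measurable X]setTI; exact: mf.
by rewrite -[X in measurable X]setTI; exact: mF.
Qed.

Lemma measurable_truncn (R : realType) (f : T -> R) :
  measurable_fun setT f -> measurable_fun setT (fun w => Num.truncn (f w)).
Proof.
move=> mf; apply: measurable_fun_natP => -[|n].
  by rewrite (_ : [set _ | _] = setT)//; exact/seteqP.
under eq_fun do rewrite truncn_gt_nat.
by rewrite -[X in measurable X]setTI; apply: measurable_fun_ler => //; exact: measurable_cst.
Qed.

End measurable_nat_valued.

Section dyadic.
Context (R : realType).
Implicit Types (x : R) (n : nat).

(** [dyadic_index n x] numbers the first point of the grid of mesh 2^-n that lies
    strictly to the right of [x]. *)
Definition dyadic_index n x : nat := (Num.truncn (2 ^+ n * x)).+1.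
Definition dyadic n (i : nat) : R := i%:R / 2 ^+ n.
Definition dyadic_above n x : R := dyadic n (dyadic_index n x).

Lemma dyadic_ge0 n i : 0 <= dyadic n i.
Proof. by rewrite divr_ge0// exprn_ge0. Qed.

Lemma dyadic_above_gt n x : 0 <= x -> x < dyadic_above n x.
Proof.
move=> x0; rewrite /dyadic_above /dyadic ltr_pdivlMr ?exprn_gt0// mulrC.
by rewrite truncnS_gt.
Qed.

Lemma dyadic_above_le n x : 0 <= x -> dyadic_above n x <= x + 2 ^- n.
Proof.
move=> x0; rewrite /dyadic_above /dyadic ler_pdivrMr ?exprn_gt0// mulrDl.
rewrite mulVf ?gt_eqF ?exprn_gt0// /dyadic_index -natr1 lerD2r [leRHS]mulrC.
by rewrite truncn_le mulr_ge0// exprn_ge0.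
Qed.

Lemma cvg_dyadic_above x : 0 <= x -> dyadic_above n x @[n --> \oo] --> x^'+.
Proof.
move=> x0 A [e /= e0 eA].
have : (2^-1 : R) ^+ n @[n --> \oo] --> 0 by apply: cvg_expr; rewrite ger0_norm ?invf_lt1 ?ltr1n.
move=> /cvgrPdist_lt /(_ e e0) [N _ NP]; exists N => // n /NP /=.
rewrite sub0r normrN exprVn ger0_norm ?invr_ge0 ?exprn_ge0// => ne.
apply: eA; last exact: dyadic_above_gt.
have := dyadic_above_gt n x0; have := dyadic_above_le n x0.
rewrite /ball /= ltr_norml; set a := dyadic_above _ _; set b := _ ^- _ in ne *.
by move=> *; apply/andP; split; lra.
Qed.

Lemma measurable_dyadic_index d (T : measurableType d) n (f : T -> R) :
  measurable_fun setT f -> measurable_fun setT (fun w => dyadic_index n (f w)).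
Proof.
move=> mf; apply: (@measurableT_comp _ _ _ _ _ _ S) => //.
by apply: measurable_truncn; exact: measurable_funM.
Qed.

End dyadic.
Arguments dyadic_above {R}.
Arguments dyadic {R}.
Arguments dyadic_index {R}.

Section right_continuous_evaluation.
Context (R : realType) d (T : measurableType d) (X : R -> T -> R).

(** A right-continuous process is the limit of its values at the next dyadic
    time, and only countably many times occur at each stage: the process
    can thus be evaluated at a random time without any measurability
    assumption in the time variable. *)
Lemma measurable_right_continuous_eval d' (S : measurableType d') (tau : S -> R)
    (g : S -> T) :
  (forall t, 0 <= t -> measurable_fun setT (X t)) ->
  (forall w t, 0 <= t -> X x w @[x --> t^'+] --> X t w) ->
  (forall s, 0 <= tau s) -> measurable_fun setT tau -> measurable_fun setT g ->
  measurable_fun setT (fun s => X (tau s) (g s)).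
Proof.
move=> mX rX tau0 mtau mg.
apply: (measurable_fun_cvg (h := fun n s => X (dyadic_above n (tau s)) (g s))).
  move=> n; apply: (measurable_nat_index (f := fun s => dyadic_index n (tau s))
                                         (F := fun i s => X (dyadic n i) (g s))).
    exact: measurable_dyadic_index.
  by move=> i; apply: measurableT_comp => //; apply: mX; exact: dyadic_ge0.
by move=> s _; apply: cvg_comp (rX _ _ (tau0 s)); exact: cvg_dyadic_above.
Qed.

End right_continuous_evaluation.

(** * Time averages and potential measures *)
Section halfline.
Context (R : realType).
Local Open Scope ereal_scope.

(** Lebesgue measure of the nonnegative times, kept as a measure on all reals so
    that product measures and Fubini's theorem apply to it directly. *)
Definition halfline : set (measurableTypeR R) -> \bar R :=
  mrestr (@lebesgue_measure R) (@measurable_itv R `[0%R, +oo[).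

Lemma halflineE A : halfline A = lebesgue_measure (A `&` `[0%R, +oo[).
Proof. by []. Qed.

HB.instance Definition _ := Measure.on halfline.

Let halfline_sigma_finite : sigma_finite setT halfline.
Proof.
have /sigma_finiteP[F [FT _ mF]] := sigma_finiteT (@lebesgue_measure R).
exists F => // n; have [mFn Fn] := mF n; split => //.
apply: le_lt_trans Fn; rewrite halflineE.
by apply: le_measure; rewrite ?inE//; exact: measurableI.
Qed.

HB.instance Definition _ :=
  Measure_isSigmaFinite.Build _ _ _ halfline halfline_sigma_finite.

Lemma integral_halfline (f : R -> \bar R) :
  measurable_fun setT f -> (forall x, 0 <= f x) ->
  \int[halfline]_x f x = \int[@lebesgue_measure R]_(x in `[0%R, +oo[) f x.
Proof.
move=> mf f0.
rewrite (@ge0_negligible_integral _ _ _ halfline setT (~` `[0%R, +oo[))//.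
- rewrite setTD setCK; apply: eq_measure_integral => A mA A0.
  by rewrite [LHS]halflineE setIidl.
- by apply: (@measurableC _ (measurableTypeR R)); exact: measurable_itv.
- by rewrite [LHS]halflineE setICl measure0.
Qed.

(** The end points are left free: monotone paths determine their level sets only
    up to the end points. *)
Lemma halfline_between (A : set R) (a b : R) : measurable A ->
  (0 <= a)%R -> (a <= b)%R ->
  (forall x, (0 <= x)%R -> (a < x)%R -> (x < b)%R -> A x) ->
  (forall x, (0 <= x)%R -> A x -> (a <= x <= b)%R) ->
  halfline A = (b - a)%:E.
Proof.
move=> mA a0 ab sub sup; rewrite halflineE; apply/eqP; rewrite eq_le.
apply/andP; split.
  have -> : (b - a)%:E = @lebesgue_measure R `[a, b].
    rewrite lebesgue_measure_itv/= lte_fin.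
    by case: ltgtP ab => // -> _; rewrite subrr.
  apply: le_measure; rewrite ?inE//; first exact: measurableI.
  by move=> x [Ax]/=; rewrite !in_itv/= andbT => x0; exact: sup.
have -> : (b - a)%:E = @lebesgue_measure R `]a, b[.
  rewrite lebesgue_measure_itv/= lte_fin.
  by case: ltgtP ab => // -> _; rewrite subrr.
apply: le_measure; rewrite ?inE//; first exact: measurableI.
move=> x /=; rewrite in_itv/= => /andP[ax xb].
have x0 : (0 <= x)%R by rewrite ltW// (le_lt_trans a0).
by split; [exact: sub|rewrite /= in_itv/= x0].
Qed.

(** This is the total mass of the exponential distribution. *)
Lemma integral_halfline_expR (a : R) : (0 < a)%R ->
  \int[halfline]_x (expR (- x * a))%:E = (a^-1)%:E.
Proof.
move=> a0.
have mE : measurable_fun setT (fun x : R => (expR (- x * a))%:E).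
  apply/measurable_EFinP/measurableT_comp => //.
  by apply: measurable_funM => //; exact: measurableT_comp.
rewrite integral_halfline//.
have : \int[@lebesgue_measure R]_(x in `[0%R, +oo[) (a%:E * (expR (- x * a))%:E) = 1.
  rewrite -(integral_exponential_pdf a0) integral_mkcond.
  apply: eq_integral => x _; rewrite /exponential_pdf !patchE.
  by case: ifP => // _; rewrite -EFinM mulNr mulNr (mulrC x).
rewrite ge0_integralZl//=; last 2 first.
- exact: (@measurable_funTS _ _ (measurableTypeR R)).
- by rewrite lee_fin ltW.
set I := \int[_]_(x in _) _ => aI.
have : (a^-1)%:E * (a%:E * I) = (a^-1)%:E by rewrite aI mule1.
by rewrite muleA -EFinM mulVf ?gt_eqF// mul1e => ->.
Qed.

End halfline.

Section potential_measure.
Context (R : realType) d (T : measurableType d) (P : probability T R).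
Variable X : R -> T -> R.

(** Negative times are sent to 0, for a process is constrained at nonnegative
    times only. *)
Definition path_eval (p : measurableTypeR R * T) : R := X (Num.max 0 p.1) p.2.

(** The proof of joint measurability is an argument of the definition because the
    image of a measure is a measure for measurable maps only. *)
Definition potential of measurable_fun [set: measurableTypeR R * T] path_eval :=
  pushforward ((@halfline R) \x P)%E path_eval.

Hypothesis mX : measurable_fun [set: measurableTypeR R * T] path_eval.
Local Open Scope ereal_scope.

Let potential0 : potential mX set0 = 0. Proof. exact: measure0. Qed.
Let potential_ge0 A : 0 <= potential mX A. Proof. exact: measure_ge0. Qed.
Let potential_sigma_additive : semi_sigma_additive (potential mX).
Proof. exact: (@measure_semi_sigma_additive _ _ _ (pushforward ((@halfline R) \x P)%E path_eval)). Qed.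

HB.instance Definition _ := isMeasure.Build _ _ _ (potential mX)
  potential0 potential_ge0 potential_sigma_additive.

Lemma integral_potential (f : R -> \bar R) :
  measurable_fun setT f -> (forall x, 0 <= f x) ->
  \int[potential mX]_x f x =
  \int[@halfline R]_x \int[P]_w f (X (Num.max 0 x)%R w).
Proof.
move=> mf f0.
rewrite /potential ge0_integral_pushforward// preimage_setT.
rewrite fubini_tonelli1//; first exact: measurableT_comp.
by move=> x; exact: f0.
Qed.

Lemma potentialE A : measurable A ->
  potential mX A = \int[@halfline R]_x P (X (Num.max 0 x)%R @^-1` A).
Proof.
move=> mA; transitivity (\int[potential mX]_x (\1_A x)%:E).
  by rewrite integral_indic// setIT.
rewrite integral_potential//; last first.
  by apply/measurable_EFinP; exact: measurable_indic.
have mXx x : measurable_fun setT (X (Num.max 0 x)%R).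
  exact: (measurableT_comp mX (measurable_pair1 x)).
apply: eq_integral => x _.
transitivity (\int[P]_w (\1_(X (Num.max 0 x)%R @^-1` A) w)%:E) => //.
rewrite integral_indic ?setIT//.
by rewrite -[X in measurable X]setTI; exact: mXx.
Qed.

End potential_measure.

(** * Measures whose Laplace transform is a power *)
Section sharp_cutoff.
Context (R : realType).
Implicit Types (w y : R) (n m : nat).

(** On [0, 1] these polynomials in [w] converge to the indicator of
    1/2 <= w; they vanish at 0, so that with w = exp(- s x) they are finite
    combinations of exponentials exp(- r x) with r > 0, which a Laplace
    transform determines.  The exponent (n + 1) 2^(n + 1) makes the transition
    happen at 1/2. *)
Definition cutoff n w : R := 1 - (1 - w ^+ n.+1) ^+ (n.+1 * 2 ^ n.+1).

Lemma bernoulli_ineq m y : 0 <= y <= 1 -> 1 - m%:R * y <= (1 - y) ^+ m.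
Proof.
move=> /andP[y0 y1]; elim: m => [|m IH]; first by rewrite expr0 mul0r subr0.
rewrite exprS (le_trans _ (ler_wpM2l _ IH)) ?subr_ge0//.
have : 0 <= m%:R * y ^+ 2 by rewrite mulr_ge0// sqr_ge0.
rewrite -natr1; nra.
Qed.

Lemma cutoff_ge0 n w : 0 <= w <= 1 -> 0 <= cutoff n w.
Proof.
move=> /andP[w0 w1]; rewrite subr_ge0 exprn_ile1// ?subr_ge0 ?exprn_ile1//.
by rewrite gerBl exprn_ge0.
Qed.

Lemma cutoff_le1 n w : 0 <= w <= 1 -> cutoff n w <= 1.
Proof.
by move=> /andP[w0 w1]; rewrite gerBl exprn_ge0// subr_ge0 exprn_ile1.
Qed.

Lemma cutoff_le n w : 0 <= w <= 1 -> cutoff n w <= n.+1%:R * (2 * w) ^+ n.+1.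
Proof.
move=> /andP[w0 w1].
have y01 : 0 <= w ^+ n.+1 <= 1 by rewrite exprn_ge0// exprn_ile1.
have := bernoulli_ineq (n.+1 * 2 ^ n.+1) y01.
by rewrite natrM natrX exprMn mulrA /cutoff => ?; lra.
Qed.

(** A bound by a multiple of [w], uniform in [n]: it is what dominated
    convergence needs, [w] being integrable once w = exp(- s x). *)
Lemma cutoff_dominated n w : 0 <= w <= 1 -> cutoff n w <= 4 * w.
Proof.
move=> w01; have /andP[w0 w1] := w01.
have [w4|w4] := leP (4^-1) w.
  by rewrite (le_trans (cutoff_le1 _ w01))//; lra.
apply: (le_trans (cutoff_le n w01)).
have : n.+1%:R * (2 * w) ^+ n <= 1.
  apply: (@le_trans _ _ ((2 ^ n)%:R * (2^-1) ^+ n)).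
    apply: ler_pM; rewrite ?exprn_ge0 ?mulr_ge0//; first by rewrite ler_nat ltn_expl.
    by apply: lerXn2r; rewrite ?nnegrE ?mulr_ge0//; lra.
  by rewrite natrX exprVn mulfV// expf_neq0.
by move=> ?; rewrite exprS; nra.
Qed.

(** With q the square root of r, n q^n is at most 1 + q + q^2 + ..., and the
    other factor q^n tends to 0. *)
Lemma cvg_natr_expr (r : R) : 0 <= r < 1 -> n.+1%:R * r ^+ n.+1 @[n --> \oo] --> 0.
Proof.
move=> /andP[r0 r1].
pose q := Num.sqrt r.
have q0 : 0 <= q by rewrite sqrtr_ge0.
have q1 : q < 1 by rewrite -sqrtr1 ltr_sqrt.
have qn n : n%:R * q ^+ n <= (1 - q)^-1.
  rewrite -[leRHS]mul1r ler_pdivlMr ?subr_gt0//.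
  have H : n%:R * q ^+ n <= \sum_(i < n) q ^+ i.
    rewrite -[n in n%:R]card_ord -sum1_card natr_sum mulr_suml ler_sum// => i _.
    by rewrite mul1r ler_wiXn2l ?(ltW q1)// ltnW.
  apply: (le_trans (ler_wpM2r _ H)); first by rewrite subr_ge0 ltW.
  have := subrX1 q n; rewrite -(opprB 1 q) mulNr mulrC.
  set S := \sum_(i < n) _ => E.
  have -> : S * (1 - q) = 1 - q ^+ n by rewrite -[LHS]opprK -E; ring.
  by rewrite gerBl exprn_ge0.
have qr : r = q ^+ 2 by rewrite sqr_sqrtr.
apply: (@squeeze_cvgr _ _ _ _ (cst 0) (fun n => (1 - q)^-1 * q ^+ n.+1)).
- apply: nearW => n; rewrite mulr_ge0 ?exprn_ge0//= qr -exprM mulnC exprM.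
  by rewrite [_ ^+ 2]expr2 mulrA ler_wpM2r ?exprn_ge0.
- exact: cvg_cst.
- rewrite -(mulr0 (1 - q)^-1); apply: cvgMr.
  rewrite (cvg_shiftS (fun n => q ^+ n)); apply: cvg_expr.
  by rewrite ger0_norm.
Qed.

Lemma cvg_cutoff w : 0 <= w <= 1 ->
  cutoff n w @[n --> \oo] --> ((2^-1 <= w)%R%:R : R).
Proof.
move=> w01; have /andP[w0 w1] := w01.
have [w2|w2] := leP 2^-1 w; last first.
  apply: (@squeeze_cvgr _ _ _ _ (cst 0)
    (fun n => n.+1%:R * (2 * w) ^+ n.+1)).
  - by apply: nearW => n; rewrite cutoff_ge0// cutoff_le.
  - exact: cvg_cst.
  - by apply: cvg_natr_expr; rewrite mulr_ge0//=; lra.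
apply: (@squeeze_cvgr _ _ _ _ (fun n => 1 - (expR (-1)) ^+ n.+1) (cst 1)).
- apply: nearW => n; rewrite cutoff_le1// andbT lerD2l lerN2.
  have y1 : w ^+ n.+1 <= 1 by rewrite exprn_ile1.
  apply: (@le_trans _ _ (expR (- w ^+ n.+1) ^+ (n.+1 * 2 ^ n.+1))).
    by apply: lerXn2r; rewrite ?nnegrE ?subr_ge0 ?expR_ge0//; exact: expR_ge1Dx.
  rewrite -!expRM_natl ler_expR mulrN mulrN1 lerN2 natrM natrX -mulrA -exprMn.
  by rewrite ler_peMr// exprn_ege1//; lra.
- rewrite -[X in _ --> X]subr0; apply: cvgB; first exact: cvg_cst.
  rewrite (cvg_shiftS (fun n => expR (-1) ^+ n)); apply: cvg_expr.
  by rewrite ger0_norm ?expR_ge0// expR_lt1// ltrN10.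
- exact: cvg_cst.
Qed.

End sharp_cutoff.

Section laplace_power_law.
Context (R : realType) (mu : {measure set R -> \bar R}) (alpha : R).
Hypothesis alpha0 : 0 < alpha.
Hypothesis mu_neg : mu `]-oo, 0[%classic = 0%E.
Hypothesis laplace : forall s : R, 0 < s ->
  (\int[mu]_x (expR (- s * x))%:E = (s `^ (- alpha))%:E)%E.
Local Open Scope ereal_scope.
Let D : set R := `[0%R, +oo[%classic.
Let mD : measurable D. Proof. exact: measurable_itv. Qed.

Let mE (s : R) A : measurable_fun A (fun x : R => (expR (- s * x))%:E).
Proof.
by apply/measurable_funTS/measurable_EFinP/measurableT_comp => //;
  exact: measurable_funM.
Qed.

Let laplaceD (s : R) : (0 < s)%R ->
  \int[mu]_(x in D) (expR (- s * x))%:E = (s `^ (- alpha))%:E.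
Proof.
move=> s0; rewrite -laplace//.
rewrite [RHS](@ge0_negligible_integral _ _ _ mu setT `]-oo, 0%R[%classic)//.
  by rewrite setTD /D; congr integral; apply/seteqP; split=> x /=;
    rewrite !in_itv/= andbT leNgt => /negP.
Qed.

Let integrableD (s : R) : (0 < s)%R ->
  mu.-integrable D (fun x => (expR (- s * x))%:E).
Proof.
move=> s0; apply/integrableP; split => //.
under eq_integral do rewrite /= ger0_norm ?expR_ge0//.
by rewrite laplaceD// ltry.
Qed.

Lemma integral_exp_polynomial (s : R) m (c r : nat -> R) : (0 < s)%R ->
  (forall j, 0 < r j)%R ->
  \int[mu]_(x in D) (\sum_(j < m) c j * expR (- (s * r j) * x))%:E =
  (s `^ (- alpha) * \sum_(j < m) c j * r j `^ (- alpha))%:E.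
Proof.
move=> s0 r0.
have i0 (j : 'I_m) : mu.-integrable D
    (fun x => (c j)%:E * (expR (- (s * r j) * x))%:E).
  by apply: integrableZl => //; apply: integrableD; exact: mulr_gt0.
under eq_integral do rewrite -sumEFin.
rewrite (integral_sum _ (f := fun (j : 'I_m) x => (c j * expR (- (s * r j) * x))%:E))//.
rewrite mulr_sumr -sumEFin; apply: eq_bigr => j _.
under eq_integral do rewrite EFinM.
rewrite integralZl//; last by apply: integrableD; rewrite mulr_gt0.
by rewrite laplaceD ?mulr_gt0// -EFinM powRM ?ltW// mulrCA.
Qed.

(** Each exponential rate scales by [s], hence every term of the expanded
    polynomial by the same factor. *)
Lemma integral_cutoff (s : R) n : (0 < s)%R ->
  \int[mu]_(x in D) (cutoff n (expR (- s * x)))%:E =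
  (s `^ (- alpha))%:E * \int[mu]_(x in D) (cutoff n (expR (- 1 * x)))%:E.
Proof.
pose m := (n.+1 * 2 ^ n.+1)%N.
pose c j : R := (- (-1) ^+ j.+1 * 'C(m, j.+1)%:R)%R.
pose r j : R := (n.+1 * j.+1)%:R.
have r0 j : (0 < r j)%R by rewrite /r ltr0n muln_gt0.
have cutE (s' x : R) : cutoff n (expR (- s' * x)) =
    (\sum_(j < m) c j * expR (- (s' * r j) * x))%R.
  rewrite /cutoff exprDn big_ord_recl expr1n expr0 mulr1 bin0 mulr1n opprD addNKr.
  rewrite -sumrN; apply: eq_bigr => j _; rewrite expr1n mul1r lift0.
  rewrite -mulr_natr exprNn -exprM -expRM_natl /c /r.
  have -> : ((n.+1 * j.+1)%:R * (- s' * x) = - (s' * (n.+1 * j.+1)%:R) * x)%R.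
    by ring.
  by ring.
move=> s0; under eq_integral do rewrite cutE.
rewrite integral_exp_polynomial//.
under [in RHS]eq_integral do rewrite cutE.
by rewrite integral_exp_polynomial// powR1 mul1r EFinM.
Qed.

(** The rate ln 2 / t is chosen so that exp(- s x) >= 1/2 exactly when
    x <= t. *)
Lemma cvg_integral_cutoff (t : R) : (0 < t)%R ->
  mu `]-oo, t]%classic < +oo /\
  (\int[mu]_(x in D) (cutoff n (expR (- (ln 2 / t) * x)))%:E) @[n --> \oo] -->
  mu `]-oo, t]%classic.
Proof.
move=> t0.
have l2 : (0 < ln 2 :> R)%R by rewrite ln_gt0// ltr1n.
set s := (ln 2 / t)%R.
have s0 : (0 < s)%R by rewrite divr_gt0.
have w01 x : D x -> (0 <= expR (- s * x) <= 1)%R.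
  rewrite /D/= in_itv/= andbT => x0.
  by rewrite expR_ge0 expR_le1 mulNr oppr_le0 mulr_ge0// ltW.
have half x : (2^-1 <= expR (- s * x))%R = (x <= t)%R.
  have -> : (2^-1 = expR (- ln 2) :> R)%R by rewrite expRN lnK ?posrE.
  rewrite ler_expR mulNr lerN2 /s.
  by rewrite mulrAC ler_pdivrMr// ler_pM2l.
have muE : mu `]-oo, t]%classic = \int[mu]_(x in D) (\1_`]-oo, t]%classic x)%:E.
  rewrite integral_indic//.
  rewrite (_ : `]-oo, t]%classic = (`]-oo, t]%classic `&` D) `|` `]-oo, 0%R[%classic); last first.
    apply/seteqP; split => x; rewrite /D /= !in_itv/= ?andbT.
      by move=> xt; case: (leP 0%R x) => ?; [left|right].
    by case=> [[]//|x0]; rewrite ltW// (lt_trans x0).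
  rewrite measureU//; last 2 first.
    by apply: measurableI; exact: measurable_itv.
    apply/seteqP; split => // x [[_]]; rewrite /D /= !in_itv/= ?andbT => x0.
    by rewrite ltNge x0.
  rewrite setIUl -setIA setIid (_ : `]-oo, 0%R[%classic `&` D = set0) ?setU0.
    by rewrite -[RHS]adde0; congr (_ + _); exact: mu_neg.
  apply/seteqP; split => // x []; rewrite /D /= !in_itv/= ?andbT => x0.
  by rewrite leNgt x0.
have mcut n : measurable_fun D (fun x : R => (cutoff n (expR (- s * x)))%:E).
  apply/measurable_EFinP; rewrite /cutoff; apply: measurable_funB => //.
  apply: measurable_funX; apply: measurable_funB => //.
  apply: measurable_funX; apply/measurable_EFinP; exact: mE.
have [] := @dominated_convergence _ _ _ mu D mD
  (fun n x => (cutoff n (expR (- s * x)))%:E)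
  (fun x => (\1_`]-oo, t]%classic x)%:E)
  (fun x => (4 * expR (- s * x))%:E) mcut.
- by apply/measurable_EFinP; exact: measurable_indic.
- apply: aeW => x Dx; apply/cvg_EFin; first exact: nearW.
  rewrite /= indicE (_ : (x \in _) = (x <= t)%R) -?half.
    exact: cvg_cutoff (w01 _ Dx).
  by apply/idP/idP; rewrite inE/= in_itv/= half.
- under eq_fun do rewrite EFinM; apply: integrableZl => //.
  exact: integrableD.
- apply: aeW => x n Dx /=; rewrite lee_fin ger0_norm.
    exact: cutoff_dominated (w01 _ Dx).
  exact: cutoff_ge0 (w01 _ Dx).
rewrite -muE => i1 _ c; split => //.
move/integrableP : i1 => [_].
by under eq_integral do rewrite /= ger0_norm//; rewrite -muE.
Qed.

(** A special case of the uniqueness of Laplace transforms, in which the scaling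
    s -> s^(- alpha) does all the work: the smoothed distribution functions at
    [t] and at 1 differ by the factor t^alpha, and so do their limits.  The
    constant is positive because a zero measure has Laplace transform zero. *)
Lemma laplace_power_law : exists2 C, (0 < C)%R &
  forall t : R, (0 < t)%R -> mu `]-oo, t]%classic = (C * t `^ alpha)%:E.
Proof.
have l2 : (0 < ln 2 :> R)%R by rewrite ln_gt0// ltr1n.
have [fin1 cvg1] := cvg_integral_cutoff ltr01.
pose C := fine (mu `]-oo, 1%R]%classic).
have CE : mu `]-oo, 1%R]%classic = C%:E by rewrite /C fineK// ge0_fin_numE.
have main (t : R) : (0 < t)%R -> mu `]-oo, t]%classic = (C * t `^ alpha)%:E.
  move=> t0; have [fint cvgt] := cvg_integral_cutoff t0.
  have E : ((ln 2 / t) `^ (- alpha) = t `^ alpha * (ln 2 / 1) `^ (-alpha))%R.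
    rewrite divr1 powRM ?invr_ge0 ?ltW// mulrC; congr (_ * _)%R.
    by rewrite -powR_inv1 ?ltW// -powRrM mulN1r opprK.
  have H : \int[mu]_(x in D) (cutoff n (expR (- (ln 2 / t) * x)))%:E
      @[n --> \oo] --> (t `^ alpha)%:E * mu `]-oo, 1%R]%classic.
    rewrite (_ : (fun n => _) = (fun n => (t `^ alpha)%:E *
      \int[mu]_(x in D) (cutoff n (expR (- (ln 2 / 1) * x)))%:E)).
      exact: cvgeZl.
    apply/funext => n; rewrite (integral_cutoff _ (divr_gt0 l2 t0)).
    by rewrite [in RHS](integral_cutoff _ (divr_gt0 l2 ltr01)) E EFinM -[LHS]muleA.
  by rewrite (cvg_unique _ cvgt H)// CE mulrC EFinM.
exists C => //.
rewrite lt_neqAle -lee_fin -CE measure_ge0 andbT eq_sym; apply/eqP => C0.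
have muT : mu setT = 0.
  have -> : [set: R] = \bigcup_n `]-oo, n.+1%:R]%classic.
    apply/seteqP; split => // x _; exists (Num.truncn x) => //=.
    by rewrite in_itv/= ltW// truncnS_gt.
  apply/negligibleP; first exact: bigcupT_measurable.
  apply: negligible_bigcup => n; apply/negligibleP; first exact: measurable_itv.
  by have := main n.+1%:R (ltr0Sn _ _); rewrite C0 mul0r.
have := laplace ltr01; rewrite powR1.
rewrite (@ge0_negligible_integral _ _ _ mu setT setT)//.
by rewrite setDv integral_set0 => -[] /esym/eqP; rewrite oner_eq0.
Qed.

End laplace_power_law.

(** * Independent increments and the potential of a stable subordinator *)
Section almost_everywhere.
Context (R : realType) d (T : measurableType d) (mu : {measure set T -> \bar R}).

Lemma ae_measure_eq (A B : set T) : measurable A -> measurable B ->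
  {ae mu, forall w, A w <-> B w} -> mu A = mu B.
Proof.
move=> mA mB AB.
rewrite -[A]setIT -[B]setIT -!integral_indic//.
apply: ge0_ae_eq_integral => //.
- by apply/measurable_EFinP; exact: measurable_indic.
- by apply/measurable_EFinP; exact: measurable_indic.
- apply: filterS AB => w AB _; congr EFin; rewrite !indicE.
  by congr (_%:R); congr nat_of_bool; apply/idP/idP; rewrite !inE => /AB.
Qed.

Lemma ae_forall_nat (Q : nat -> T -> Prop) :
  (forall n, {ae mu, forall w, Q n w}) -> {ae mu, forall w n, Q n w}.
Proof.
move=> aeQ.
have : mu.-negligible (\bigcup_n ~` [set w | Q n w]).
  by apply: negligible_bigcup => n; exact: aeQ.
apply: negligibleS => w /= /existsNP[n nQ]; by exists n.
Qed.

Lemma ae_null (A : set T) : measurable A -> mu A = 0%E -> {ae mu, forall w, ~ A w}.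
Proof.
move=> mA A0; have nA : mu.-negligible A by apply/negligibleP.
by apply: negligibleS nA => w /= /contrapT.
Qed.

End almost_everywhere.

Section independent_pairs.
Context (R : realType) d (T : measurableType d) (P : probability T R).

Lemma mutually_independent_pair d' (U : measurableType d') (X : nat -> T -> U)
    (i j : nat) (A B : set U) :
  mutually_independent P X -> i != j -> measurable A -> measurable B ->
  P (X i @^-1` A `&` X j @^-1` B) = (P (X i @^-1` A) * P (X j @^-1` B))%E.
Proof.
move=> indX ij mA mB.
pose C k := if k == i then A else if k == j then B else setT.
have mC k : measurable (C k) by rewrite /C; do 2 case: ifP => // _.
have Ci : C i = A by rewrite /C eqxx.
have Cj : C j = B by rewrite /C eq_sym (negbTE ij) eqxx.
have := indX [fset i; j]%fset C mC.
rewrite big_fsetU1/= ?inE// big_seq_fset1 Ci Cj => <-; congr (P _).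
apply/seteqP; split => w /=.
  by move=> [wA wB] k /=; rewrite !inE => /orP[] /eqP ->; rewrite ?Ci ?Cj.
move=> H; split; rewrite -?Ci -?Cj; apply: H; rewrite /= !inE eqxx ?orbT//.
Qed.

(** Independence of the increments over [0, x] and [x, x + z], together with
    X_0 = 0 and stationarity. *)
Lemma levy_joint_law (X : R -> T -> R) (x z : R) (A B : set R) :
  levy_process P X -> 0 <= x -> 0 <= z -> measurable A -> measurable B ->
  P (X x @^-1` A `&` (fun w => X (x + z) w - X x w) @^-1` B) =
  (P (X x @^-1` A) * P (X z @^-1` B))%E.
Proof.
move=> LX x0 z0 mA mB.
have mX := levy_measurable LX.
(* the times 0, x, x + z, x + z, ... *)
pose t (n : nat) := if n is n'.+1 then (if n' is _.+1 then x + z else x) else 0 : R.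
have t0 : 0 <= t 0%N by [].
have tm : {homo t : m n / (m <= n)%N >-> m <= n}.
  by case=> [|[|m]] [|[|n]]//= _; rewrite ?addr_ge0// lerDl.
have := mutually_independent_pair (levy_independent LX t0 tm) (isT : 0 != 1)%N mA mB.
rewrite /= (levy_stationary LX)//.
have X0 (E : set R) : measurable E ->
    {ae P, forall w, E (X x w - X 0 w) <-> E (X x w)}.
  by move=> mE; apply: filterS (levy_start LX) => w ->; rewrite subr0.
have mpre (f : T -> R) E : measurable_fun setT f -> measurable E ->
    measurable (f @^-1` E).
  by move=> mf mE; rewrite -[Y in measurable Y]setTI; exact: mf.
have mXx : measurable_fun setT (X x) by exact: mX.
have mX0 : measurable_fun setT (fun w => X x w - X 0 w).
  by apply: measurable_funB; exact: mX.
have mXz : measurable_fun setT (fun w => X (x + z) w - X x w).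
  by apply: measurable_funB; apply: mX => //; exact: addr_ge0.
have -> : P ((fun w => X x w - X 0 w) @^-1` A) = P (X x @^-1` A).
  by apply: ae_measure_eq; [exact: mpre|exact: mpre|exact: X0].
move=> <-; apply: ae_measure_eq; rewrite ?/setI; try by apply: measurableI; exact: mpre.
by apply: filterS (X0 _ mA) => w /= [H1 H2]; split=> -[? ?]; split; auto.
Qed.

(** The joint law is a product measure as it is one on rectangles. *)
Lemma levy_pair_law (X : R -> T -> R) (x z : R) (A : set (R * R)) :
  levy_process P X -> 0 <= x -> 0 <= z -> measurable A ->
  P ((fun w => (X x w, X (x + z) w - X x w)) @^-1` A) =
  (\int[P]_w P (X z @^-1` xsection A (X x w)))%E.
Proof.
move=> LX x0 z0 mA.
have mX := levy_measurable LX.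
have mpair : measurable_fun setT (fun w => (X x w, X (x + z) w - X x w)).
  apply: measurable_fun_pair; first exact: mX.
  by apply: measurable_funB; apply: mX => //; exact: addr_ge0.
pose Xx : {RV P >-> R} := HB.pack (X x) (isMeasurableFun.Build _ _ _ _ _ (mX x x0)).
pose Xz : {RV P >-> R} := HB.pack (X z) (isMeasurableFun.Build _ _ _ _ _ (mX z z0)).
pose Z : {RV P >-> (R * R)%type} := HB.pack (fun w => (X x w, X (x + z) w - X x w))
  (isMeasurableFun.Build _ _ _ _ _ mpair).
transitivity (distribution P Z A) => //.
rewrite -(@product_measure_unique _ _ _ _ R (distribution P Xx) (distribution P Xz)
  (distribution P Z))//; last first.
  by move=> B C mB mC; rewrite -(levy_joint_law LX x0 z0 mB mC).
rewrite /product_measure1 ge0_integral_distribution//.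
exact: measurable_fun_xsection.
Qed.

End independent_pairs.

Section subordinator.
Context (R : realType) d (T : measurableType d) (P : probability T R).
Context (alpha : R) (D : R -> T -> R).
Hypothesis SD : stable_subordinator P alpha D.
Let LD := stable_levy SD.

Lemma measurable_subordinator_eval :
  measurable_fun [set: measurableTypeR R * T] (path_eval D).
Proof.
apply: (@measurable_right_continuous_eval R d T D _ (measurableTypeR R * T)%type
  (fun p => Num.max 0 p.1) snd).
- exact: levy_measurable LD.
- by move=> w t t0; have [] := levy_cadlag LD w t0.
- by move=> p; rewrite le_max lexx.
- apply: measurable_maxr => //; exact: measurable_fst.
- exact: measurable_snd.
Qed.

Definition subordinator_potential := potential P measurable_subordinator_eval.
Local Notation U := subordinator_potential.
HB.instance Definition _ := Measure.on U.

(** The properties of almost every path of a subordinator on which the analysis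
    of its inverse rests. *)
Definition diverging_path (f : R -> R) := [/\ f 0 = 0,
  (forall s t, 0 <= s -> s <= t -> f s <= f t) &
  forall a, exists2 x, 0 <= x & a < f x].

(** Markov's inequality for exp(- D_x), whose mean is exp(- x). *)
Lemma subordinator_chernoff (x a : R) : 0 <= x ->
  (P [set w | (D x w <= a)%R] <= (expR (a - x))%:E)%E.
Proof.
move=> x0.
have mDx : measurable_fun setT (D x) := levy_measurable LD x0.
have mA : measurable [set w | D x w <= a].
  by rewrite -[X in measurable X]setTI; exact: measurable_fun_ler.
rewrite -[X in P X]setIT -integral_indic// expRD EFinM.
have := stable_laplace SD ltr01 x0; rewrite unlock powR1 mulr1 => <-.
rewrite -ge0_integralZl//; last first.
  apply/measurable_EFinP/measurableT_comp => //.
  exact: measurable_funM.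
apply: ge0_le_integral => //.
- by apply/measurable_EFinP; exact: measurable_indic.
- apply: measurable_funeM; apply/measurable_EFinP/measurableT_comp => //.
  exact: measurable_funM.
- move=> w _; rewrite -EFinM lee_fin indicE -expRD.
  have [|_] := boolP (w \in _); last by rewrite expR_ge0.
  rewrite inE /= => wa.
  by rewrite -[leLHS]expR0 ler_expR; lra.
Qed.

Lemma subordinator_diverging : {ae P, forall w, diverging_path (D ^~ w)}.
Proof.
have unb : {ae P, forall w (n : nat), exists m : nat, n%:R < D m%:R w}.
  apply: ae_forall_nat => n.
  pose A := \bigcap_(m : nat) [set w | D m%:R w <= n%:R].
  have mAm (m : nat) : measurable [set w | D m%:R w <= n%:R].
    rewrite -[X in measurable X]setTI; apply: measurable_fun_ler => //.
    by apply: (levy_measurable LD); exact: ler0n.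
  have mA : measurable A by exact: bigcapT_measurable.
  suff A0 : P A = 0%E.
    apply: filterS (ae_null mA A0) => w /= nA.
    apply: contrapT => /forallNP H; apply: nA => m _ /=.
    by rewrite leNgt; apply/negP; exact: H.
  have PA m : (P A <= (expR (n%:R - m%:R))%:E)%E.
    apply: le_trans (subordinator_chernoff _ (ler0n _ m)).
    by apply: le_measure; rewrite ?inE// => w; apply.
  have fA : P A \is a fin_num := fin_num_measure P _ mA.
  apply/eqP; rewrite eq_le measure_ge0 andbT.
  move: PA; rewrite -(fineK fA); move: (fine (P A)) => p PA.
  rewrite lee_fin leNgt; apply/negP => p1.
  (* a time with exp(n - m) < p *)
  pose m := (Num.truncn (n%:R - ln p)).+1.
  have := PA m; rewrite lee_fin -(@lnK _ p) ?posrE// ler_expR.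
  by have := truncnS_gt (n%:R - ln p); rewrite -/m => *; lra.
apply: filterS3 unb (stable_nondecreasing SD) (levy_start LD) => w H1 H2 H3.
split => // a; have [m am] := H1 (Num.truncn a).+1.
by exists m%:R => //; exact: lt_trans (truncnS_gt _) am.
Qed.

(** The integral over x of E exp(- s D_x) = exp(- x s^alpha). *)
Lemma laplace_subordinator_potential (s : R) : 0 < s ->
  (\int[U]_x (expR (- s * x))%:E = (s `^ (- alpha))%:E)%E.
Proof.
move=> s0.
have ms (c : R) : measurable_fun setT (fun x : R => (expR (- c * x))%:E).
  by apply/measurable_EFinP/measurableT_comp => //; exact: measurable_funM.
rewrite integral_potential//.
have s1 : 0 < s `^ alpha by rewrite powR_gt0.
rewrite powRN -integral_halfline_expR// !integral_halfline//.
- apply: eq_integral => x; rewrite inE/= in_itv/= andbT => x0.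
  have := stable_laplace SD s0 x0; rewrite unlock => <-.
  by rewrite (max_idPr x0).
- under eq_fun do rewrite mulNr mulrC -mulNr; exact: ms.
- apply: (@measurable_fun_fubini_tonelli_F _ _ _ _ _ P
    (fun p => (expR (- s * path_eval D p))%:E)) => //.
  exact: (measurableT_comp (ms s) measurable_subordinator_eval).
- by move=> x; apply: integral_ge0 => w _; rewrite lee_fin expR_ge0.
Qed.

Lemma subordinator_potential_neg : U `]-oo, 0[%classic = 0%E.
Proof.
rewrite /subordinator_potential potentialE; last exact: measurable_itv.
apply: integral0_eq => x _; apply/negligibleP.
  rewrite -[X in measurable X]setTI; apply: (levy_measurable LD) => //.
  by rewrite le_max lexx.
apply: negligibleS subordinator_diverging => w /=; rewrite in_itv/= => D0 [Dw0 Dw1 _].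
move: D0; rewrite ltNge => /negP; apply.
by rewrite -[leLHS]Dw0; apply: Dw1 => //; rewrite le_max lexx.
Qed.

Lemma subordinator_potential_power : 0 < alpha -> exists2 C, 0 < C &
  forall t : R, 0 < t -> U `]-oo, t]%classic = (C * t `^ alpha)%:E.
Proof.
move=> alpha0; apply: laplace_power_law => //.
- exact: subordinator_potential_neg.
- exact: laplace_subordinator_potential.
Qed.

(** Conditionally on D_x the increment D_(x+z) - D_x is distributed as D_z;
    integrating over z turns its law into U, and then the integral over x does
    the same to the law of D_x. *)
Lemma subordinator_double_potential (A : set (R * R)) : measurable A ->
  (\int[@halfline R]_x \int[@halfline R]_z
    P ((fun w => (D (Num.max 0%R x) w,
                  D (Num.max 0%R x + Num.max 0%R z)%R w - D (Num.max 0%R x) w)%R)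
       @^-1` A) = \int[U]_u U (xsection A u))%E.
Proof.
move=> mA.
have max0 (x : R) : 0 <= Num.max 0 x by rewrite le_max lexx.
under eq_integral => x _ do under eq_integral => z _ do
  rewrite (levy_pair_law LD)//.
have mPu : measurable_fun setT (fun p : measurableTypeR R * R =>
    P (D (Num.max 0 p.1) @^-1` xsection A p.2)).
  have mB : measurable [set q : (measurableTypeR R * R) * T |
      A (q.1.2, path_eval D (q.1.1, q.2))].
    rewrite -[X in measurable X]setTI.
    apply: (@measurable_fun_pair _ _ _ _ _ _ (fun q : (measurableTypeR R * R) * T => q.1.2)
      (fun q => path_eval D (q.1.1, q.2))) => //.
      exact: measurableT_comp.
    apply: (measurableT_comp measurable_subordinator_eval).
    by apply: measurable_fun_pair; [exact: measurableT_comp|exact: measurable_snd].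
  rewrite (_ : (fun p => _) = P \o xsection [set q | A (q.1.2, path_eval D (q.1.1, q.2))]).
    exact: measurable_fun_xsection.
  by apply/funext => p /=; congr (P _).
have mUA : measurable_fun setT (fun u => U (xsection A u)).
  rewrite (_ : (fun u => _) = (fun u =>
      (\int[@halfline R]_x P (D (Num.max 0%R x) @^-1` xsection A u))%E)).
    exact: (@measurable_fun_fubini_tonelli_G _ _ _ _ _ (@halfline R)
      (fun p => P (D (Num.max 0 p.1) @^-1` xsection A p.2))).
  by apply/funext => u; rewrite [LHS]potentialE//; exact: measurable_xsection.
rewrite [RHS]integral_potential//.
apply: eq_integral => x _.
rewrite (@fubini_tonelli _ _ _ _ _ (@halfline R) P (fun p =>
   P (D (Num.max 0 p.1)%R @^-1` xsection A (D (Num.max 0 x)%R p.2)))); last 2 first.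
- have mg : measurable_fun setT (fun p : measurableTypeR R * T =>
      ((p.1, D (Num.max 0 x)%R p.2) : measurableTypeR R * R)).
    apply: measurable_fun_pair; first exact: measurable_fst.
    have mDx := levy_measurable LD (max0 x).
    exact: (measurableT_comp mDx (@measurable_snd _ _ (measurableTypeR R) T)).
  exact: (measurableT_comp mPu mg).
- by [].
apply: eq_integral => w _.
by rewrite [RHS]potentialE//; exact: measurable_xsection.
Qed.

End subordinator.

(** * First passage times as occupation times *)
Section halfline_integrals.
Context (R : realType).

(** The area of a right triangle with legs b - a; the end points of [A] are left
    free as above. *)
Lemma halfline_triangle (A : set (measurableTypeR R)) (a b : R) : measurable A ->
  0 <= a -> a <= b ->
  (forall x, 0 <= x -> a < x -> x < b -> A x) ->
  (forall x, 0 <= x -> A x -> a <= x <= b) ->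
  (\int[@halfline R]_x (\1_A x * (b - x))%:E = ((b - a) ^+ 2 / 2)%:E)%E.
Proof.
move=> mA a0 ab sub sup.
have mg : measurable_fun setT (fun x : R => b - x).
  by apply: measurable_funB => //; exact: measurable_id.
have mgE : measurable_fun setT (fun x : R => (b - x)%:E) by exact/measurable_EFinP.
have f0 x : 0 <= \1_A x * (b - x).
  rewrite indicE; have [|_] := boolP (x \in A); last by rewrite mul0r.
  rewrite inE mul1r subr_ge0 => Ax; have [x0|x0] := leP 0 x.
    by have /andP[] := sup _ x0 Ax.
  by rewrite ltW// (lt_le_trans x0)// (le_trans a0).
have mf : measurable_fun setT (fun x : R => (\1_A x * (b - x))%:E).
  by apply/measurable_EFinP/measurable_funM => //; exact: measurable_indic.
rewrite integral_halfline//.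
have E (b0 b1 : bool) :
    (\int[@lebesgue_measure R]_(x in [set` Interval (BSide b0 a) (BSide b1 b)])
      (b - x)%:E = ((b - a) ^+ 2 / 2)%:E)%E.
  rewrite integral_itv_bndoo; last by apply/measurable_EFinP; exact: measurable_funTS.
  rewrite -(@integral_itv_bndoo _ a b _ true false);
    last by apply/measurable_EFinP; exact: measurable_funTS.
  move: ab; rewrite le_eqVlt => /orP[/eqP<-|ab].
    by rewrite set_itv1 integral_set1 subrr expr0n/= mul0r.
  have dF (x : R) : is_derive x 1 (fun x : R => - ((b - x) ^+ 2 / 2)) (b - x).
    apply: is_derive_eq.
    by rewrite /GRing.scale/=; field.
  have cF : continuous (fun x : R => - ((b - x) ^+ 2 / 2)).
    by move=> x; apply/differentiable_continuous/derivable1_diffP; exact: ex_derive.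
  rewrite (continuous_FTC2 (F := fun x => - ((b - x) ^+ 2 / 2)))//.
  - by rewrite -EFinB; congr EFin; rewrite subrr expr0n/=; ring.
  - by apply: continuous_subspaceT => x; apply: continuousB; [exact: cvg_cst|exact: cvg_id].
  - split; first by move=> x _; exact: ex_derive.
      by apply: cvg_at_right_filter; exact: cF.
    by apply: cvg_at_left_filter; exact: cF.
  - by move=> x _; rewrite derive1E; exact: derive_val.
apply/eqP; rewrite eq_le; apply/andP; split.
  rewrite -(E true false) integral_mkcond [leRHS]integral_mkcond.
  apply: ge0_le_integral => //.
  - by move=> x _; rewrite erestrict_ge0// => y _; rewrite lee_fin.
  - apply/(measurable_restrictT _ _).1 => //; exact: (@measurable_funTS _ _ (measurableTypeR R)).
  - apply/(measurable_restrictT _ _).1 => //; exact: (@measurable_funTS _ _ (measurableTypeR R) _ _ _ mgE).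
  move=> x _; rewrite !patchE !mem_setE !in_itv/= andbT.
  case: ifPn => x0; last first.
    case: ifPn => // /andP[ax xb]; rewrite lee_fin subr_ge0//.
  rewrite indicE; have [|_] := boolP (x \in A).
    by rewrite inE => Ax; rewrite (sup _ x0 Ax) mul1r.
  by rewrite mul0r; case: ifPn => // /andP[ax xb]; rewrite lee_fin subr_ge0.
rewrite -(E false true) integral_mkcond [leRHS]integral_mkcond.
apply: ge0_le_integral => //.
- move=> x _; rewrite erestrict_ge0// => y; rewrite /= in_itv/= => /andP[_ yb].
  by rewrite lee_fin subr_ge0 ltW.
- apply/(measurable_restrictT _ _).1 => //; exact: (@measurable_funTS _ _ (measurableTypeR R) _ _ _ mgE).
- apply/(measurable_restrictT _ _).1 => //; exact: (@measurable_funTS _ _ (measurableTypeR R)).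
move=> x _; rewrite !patchE !mem_setE !in_itv/= andbT.
case: ifPn => [/andP[ax xb]|_].
  have x0 : 0 <= x by rewrite ltW// (le_lt_trans a0).
  by rewrite x0 indicE mem_set ?mul1r//; exact: sub.
by case: ifPn => // _; rewrite lee_fin.
Qed.

Lemma eq_integral_halfline (f g : R -> \bar R) :
  measurable_fun setT f -> measurable_fun setT g ->
  (forall x, 0 <= f x)%E -> (forall x, 0 <= g x)%E ->
  (forall x, 0 <= x -> f x = g x) ->
  (\int[@halfline R]_x f x = \int[@halfline R]_x g x)%E.
Proof.
move=> mf mg f0 g0 fg; rewrite !integral_halfline//.
by apply: eq_integral => x; rewrite inE/= in_itv/= andbT => /fg.
Qed.

End halfline_integrals.

Section first_passage.
Context (R : realType).

Definition first_passage (f : R -> R) (t : R) : R := inf [set x : R | 0 < x /\ t < f x].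

Lemma first_passage_ge0 (f : R -> R) t : 0 <= first_passage f t.
Proof.
rewrite /first_passage; have [->|S0] := eqVneq [set x | 0 < x /\ t < f x] set0.
  by rewrite inf0.
by apply: lb_le_inf => [|x [/ltW]//]; exact/set0P.
Qed.

Variable f : R -> R.
Hypothesis df : diverging_path f.
Local Notation Y := (first_passage f).

Let f0 : f 0 = 0. Proof. by case: df. Qed.
Let fmono s t : 0 <= s -> s <= t -> f s <= f t. Proof. by case: df => _ + _; apply. Qed.
Let funb a : exists2 x, 0 <= x & a < f x. Proof. by case: df => _ _; apply. Qed.

Let nonempty t : [set x : R | 0 < x /\ t < f x] !=set0.
Proof.
have [x x0 tx] := funb t; exists (x + 1); split; first by rewrite ltr_wpDl.
by rewrite (lt_le_trans tx)// fmono// lerDl.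
Qed.

Let lb t : lbound [set x : R | 0 < x /\ t < f x] 0.
Proof. by move=> x /= [/ltW]. Qed.

Lemma first_passage_le t x : 0 <= x -> t < f x -> Y t <= x.
Proof.
move=> x0 tx; apply/ler_addgt0Pr => e e0; apply: ge_inf; first by exists 0; exact: lb.
by split; [rewrite ltr_wpDl|rewrite (lt_le_trans tx)// fmono// lerDl ltW].
Qed.

Lemma first_passage_ge t x : 0 <= x -> f x <= t -> x <= Y t.
Proof.
move=> x0 fx; apply: lb_le_inf => // y /= [y0 ty].
rewrite leNgt; apply/negP => yx; move: ty; apply/negP; rewrite -leNgt.
by rewrite (le_trans _ fx)// fmono// ltW.
Qed.

Lemma first_passage_homo : {homo Y : s t / s <= t}.
Proof.
move=> s t st; apply: lb_le_inf => // y /= [y0 ty].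
by apply: first_passage_le; [exact: ltW|exact: le_lt_trans ty].
Qed.

Lemma first_passage_lt0 t : t < 0 -> Y t = 0.
Proof.
move=> t0; apply/eqP; rewrite eq_le first_passage_ge0 andbT.
by apply: first_passage_le; rewrite ?f0.
Qed.

Hypothesis mf : measurable_fun [set: measurableTypeR R] (fun x : measurableTypeR R => f (Num.max 0 x)).

Let mf_itv x a b : 0 <= x ->
  measurable [set z : measurableTypeR R | a < f (x + Num.max 0 z) <= b].
Proof.
move=> x0; pose s (z : measurableTypeR R) : measurableTypeR R := x + Num.max 0 z.
have ms : measurable_fun setT s.
  apply: (@measurable_funD _ (measurableTypeR R)) => //.
  by apply: (@measurable_maxr _ (measurableTypeR R)) => //; exact: measurable_id.
have := measurableT_comp mf ms; rewrite /comp/= => mfs.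
have E z : Num.max 0 (s z) = s z.
  by apply/max_idPr; rewrite addr_ge0// le_max lexx.
have := mfs measurableT `]a, b]%classic (measurable_itv _); rewrite setTI.
by congr measurable; apply/seteqP; split => z; rewrite /preimage/= in_itv/= E.
Qed.

(** By monotonicity, the times z at which f (x + z) is in ]a, b] form an interval
    from Y_a - x to Y_b - x. *)
Lemma halfline_first_passage x a b : 0 <= x -> x <= Y a -> a <= b ->
  halfline [set z : measurableTypeR R | a < f (x + Num.max 0 z) <= b] = (Y b - Y a)%:E.
Proof.
move=> x0 xYa ab.
have Yab := first_passage_homo ab.
rewrite (halfline_between (a := Y a - x) (b := Y b - x)).
- by congr EFin; ring.
- exact: mf_itv.
- by rewrite subr_ge0.
- by rewrite lerD2r.
- move=> z z0; rewrite /= (max_idPr z0) ltrBlDl ltrBrDl => h1 h2.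
  have xz0 := addr_ge0 x0 z0; apply/andP; split; [rewrite ltNge|rewrite leNgt]; apply/negP => H.
    by have := first_passage_ge xz0 H; rewrite leNgt h1.
  by have := first_passage_le xz0 H; rewrite leNgt h2.
- move=> z z0; rewrite /= (max_idPr z0) lerBlDl lerBrDl => /andP[H1 H2].
  have xz0 := addr_ge0 x0 z0.
  by rewrite first_passage_le//= first_passage_ge.
Qed.

(** If x itself is already in the band, the occupation starts at once. *)
Lemma halfline_first_passage_tail x a b : 0 <= x -> a < f x -> f x <= b ->
  halfline [set z : measurableTypeR R | a < f (x + Num.max 0 z) <= b] = (Y b - x)%:E.
Proof.
move=> x0 ax xb.
rewrite (halfline_between (a := 0) (b := Y b - x)) ?subr0//.
- exact: mf_itv.
- by rewrite subr_ge0 first_passage_ge.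
- move=> z z0 _; rewrite /= (max_idPr z0) ltrBrDl => h2.
  have xz0 := addr_ge0 x0 z0; apply/andP; split.
    by rewrite (lt_le_trans ax)// fmono// lerDl.
  rewrite leNgt; apply/negP => H.
  by have := first_passage_le xz0 H; rewrite leNgt h2.
- move=> z z0; rewrite /= (max_idPr z0) lerBrDl => /andP[H1 H2].
  by rewrite z0/= first_passage_ge// addr_ge0.
Qed.

(** The occupation measure of the pairs formed by the position at a time and the
    displacement until a later time: the second coordinate is an increment, so
    that the independence of increments applies to it. *)
Definition double_occupation (A : set (R * R)) : \bar R :=
  (\int[@halfline R]_x \int[@halfline R]_z
    (\1_A (f (Num.max 0%R x), f (Num.max 0%R x + Num.max 0%R z) - f (Num.max 0%R x))%R)%:E)%E.

(** Position in ]a, b] at the earlier time and in ]c, e] at the later one, in the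
    coordinates (position, displacement). *)
Definition band (a b c e : R) : set (R * R) :=
  [set u | a < u.1 <= b /\ c < u.1 + u.2 <= e].

Let double_occupation_band_inner (a b c e : R) (g : R -> R) :
  (forall x, 0 <= x -> a < f x <= b ->
    halfline [set z : measurableTypeR R | c < f (x + Num.max 0 z) <= e] = (g x)%:E) ->
  double_occupation (band a b c e) =
  (\int[@halfline R]_x
     (\1_[set x : measurableTypeR R | (a < f (0 + Num.max 0 x) <= b)%R] x
        * g (Num.max 0%R x))%:E)%E.
Proof.
move=> hg; apply: eq_integral => x _; set x' := Num.max 0 x.
have x0 : 0 <= x' by rewrite le_max lexx.
set B := [set x : measurableTypeR R | _].
have [xA|xA] := pselect (B x); last first.
  rewrite [X in (X * _)%:E]indicE memNset//= mul0r.
  apply: integral0_eq => z _; rewrite indicE memNset//= => -[+ _].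
  by move: xA; rewrite /B /= add0r.
have xb : a < f x' <= b by move: xA; rewrite /B /= add0r.
rewrite [X in (X * _)%:E]indicE mem_set// mul1r -hg//.
rewrite -[X in halfline X]setIT -integral_indic//; last exact: mf_itv.
apply: eq_integral => z _; congr EFin; rewrite !indicE; congr (_%:R).
congr nat_of_bool.
have E : f x' + (f (x' + Num.max 0 z) - f x') = f (x' + Num.max 0 z) by ring.
by apply/idP/idP; rewrite !in_setE /band /= E => // -[].
Qed.

(** If b <= c the order of the two times is automatic, and the double integral is
    a product. *)
Lemma double_occupation_prod (a b c e : R) : a <= b -> b <= c -> c <= e ->
  double_occupation (band a b c e) = ((Y b - Y a) * (Y e - Y c))%:E.
Proof.
move=> ab bc ce.
rewrite (double_occupation_band_inner (g := fun=> Y e - Y c)); last first.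
  move=> x x0 /andP[_ xb]; apply: halfline_first_passage => //.
  by apply: first_passage_ge => //; exact: le_trans bc.
under eq_integral do rewrite mulrC EFinM.
rewrite ge0_integralZl//; last 2 first.
- by apply/measurable_EFinP; apply: measurable_indic; exact: mf_itv.
- by rewrite lee_fin subr_ge0 first_passage_homo.
rewrite integral_indic// ?setIT; last exact: mf_itv.
have H := halfline_first_passage (lexx 0) (first_passage_ge0 f a) ab.
by rewrite [X in (_ * X)%E]H -EFinM mulrC.
Qed.

(** Only ordered pairs of times are counted, which is half of the square. *)
Lemma double_occupation_square (a b : R) : a <= b ->
  double_occupation (band a b a b) = ((Y b - Y a) ^+ 2 / 2)%:E.
Proof.
move=> ab.
rewrite (double_occupation_band_inner (g := fun x => Y b - x)); last first.
  by move=> x x0 /andP[ax xb]; exact: halfline_first_passage_tail.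
set B := [set x : measurableTypeR R | _].
have mB : measurable B by exact: mf_itv.
rewrite -(@halfline_triangle _ B (Y a) (Y b)) ?first_passage_ge0 ?first_passage_homo//.
- have BY (x : R) : B x -> Num.max 0 x <= Y b.
    by rewrite /B /= add0r => /andP[_ H]; apply: first_passage_ge => //; rewrite le_max lexx.
  apply: eq_integral_halfline.
  + apply/measurable_EFinP/measurable_funM; first exact: measurable_indic.
    apply: measurable_funB => //.
    by apply: measurable_maxr => //; exact: measurable_id.
  + apply/measurable_EFinP/measurable_funM; first exact: measurable_indic.
    by apply: measurable_funB => //; exact: measurable_id.
  + move=> x; rewrite lee_fin indicE; have [|_] := boolP (x \in B); last by rewrite mul0r.
    by rewrite inE mul1r subr_ge0; exact: BY.
  + move=> x; rewrite lee_fin indicE; have [|_] := boolP (x \in B); last by rewrite mul0r.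
    rewrite inE mul1r subr_ge0 => /BY; apply: le_trans.
    by rewrite le_max lexx orbT.
  + by move=> x x0; rewrite (max_idPr x0).
- move=> x x0 h1 h2; rewrite /B /= add0r (max_idPr x0).
  apply/andP; split; [rewrite ltNge|rewrite leNgt]; apply/negP => H.
    by have := first_passage_ge x0 H; rewrite leNgt h1.
  by have := first_passage_le x0 H; rewrite leNgt h2.
- move=> x x0; rewrite /B /= add0r (max_idPr x0) => /andP[H1 H2].
  by rewrite first_passage_le//= first_passage_ge.
Qed.

Lemma halfline_occupation (a b : R) : a <= b ->
  (\int[@halfline R]_x (\1_`]a, b]%classic (f (Num.max 0%R x)))%:E = (Y b - Y a)%:E)%E.
Proof.
move=> ab; rewrite -(halfline_first_passage (lexx 0) (first_passage_ge0 f a) ab).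
rewrite -[X in halfline X]setIT -integral_indic//; last exact: mf_itv.
apply: eq_integral => z _; congr EFin; rewrite !indicE; congr (_%:R).
by congr nat_of_bool; apply/idP/idP; rewrite !in_setE /= in_itv/= add0r.
Qed.

End first_passage.

Section expected_occupation.
Context (R : realType) d (T : measurableType d) (P : probability T R).
Context (alpha : R) (D : R -> T -> R).
Hypothesis SD : stable_subordinator P alpha D.
Let LD := stable_levy SD.
Local Notation U := (subordinator_potential SD).
Local Open Scope ereal_scope.

(** Measurability in the sample point comes with the value, both by Fubini's
    theorem. *)
Lemma expected_occupation (A : set R) : measurable A ->
  measurable_fun setT (fun w => \int[@halfline R]_x (\1_A (D (Num.max 0%R x) w) : R)%:E) /\
  \int[P]_w \int[@halfline R]_x (\1_A (D (Num.max 0%R x) w))%:E = U A.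
Proof.
move=> mA; have mD := measurable_subordinator_eval SD.
have m1 : measurable_fun setT (fun p => (\1_A (path_eval D p) : R)%:E).
  apply/measurable_EFinP/measurableT_comp => //; exact: measurable_indic.
have p0 p : 0 <= (\1_A (path_eval D p) : R)%:E by rewrite lee_fin.
split; first exact: (@measurable_fun_fubini_tonelli_G _ _ _ _ _ (@halfline R) _ m1 p0).
rewrite -(@fubini_tonelli _ _ _ _ _ (@halfline R) P
  (fun p => (\1_A (path_eval D p) : R)%:E) m1); last by move=> p; rewrite lee_fin.
transitivity (\int[U]_u (\1_A u)%:E); last by rewrite integral_indic// setIT.
by rewrite integral_potential//; apply/measurable_EFinP; exact: measurable_indic.
Qed.

Lemma expected_double_occupation (A : set (R * R)) : measurable A ->
  measurable_fun setT (fun w => double_occupation (D ^~ w) A) /\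
  \int[P]_w double_occupation (D ^~ w) A = \int[U]_u U (xsection A u).
Proof.
move=> mA; rewrite -subordinator_double_potential//.
have max0 (x : R) : (0 <= Num.max 0 x)%R by rewrite le_max lexx.
pose TT := ((measurableTypeR R * T) * measurableTypeR R)%type.
pose h (q : TT) : R * R := (D (Num.max 0 q.1.1) q.1.2,
  D (Num.max 0 q.1.1 + Num.max 0 q.2) q.1.2 - D (Num.max 0 q.1.1) q.1.2)%R.
have m11 : measurable_fun setT (fun q : TT => q.1.1).
  by apply: measurableT_comp => //; exact: measurable_fst.
have mmax1 : measurable_fun setT (fun q : TT => Num.max 0%R q.1.1 : R).
  by apply: measurable_maxr => //; exact: m11.
have mmax2 : measurable_fun setT (fun q : TT => Num.max 0%R q.2 : R).
  by apply: measurable_maxr => //; exact: measurable_snd.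
have m12 : measurable_fun setT (fun q : TT => q.1.2).
  by apply: measurableT_comp => //; exact: measurable_snd.
have rc w t : (0 <= t)%R -> D x w @[x --> t^'+] --> D t w.
  by move=> t0; have [] := levy_cadlag LD w t0.
have mh : measurable_fun setT h.
  have m1 : measurable_fun setT (fun q : TT => D (Num.max 0 q.1.1)%R q.1.2).
    by apply: (measurable_right_continuous_eval (levy_measurable LD) rc) => // q; exact: max0.
  apply: measurable_fun_pair; first exact: m1.
  apply: measurable_funB; last exact: m1.
  apply: (measurable_right_continuous_eval (levy_measurable LD) rc (tau := fun q : TT =>
     (Num.max 0 q.1.1 + Num.max 0 q.2)%R)) => //.
    by move=> q; exact: addr_ge0.
  exact: measurable_funD.
have m1A : measurable_fun setT (fun q : TT => (\1_A (h q) : R)%:E).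
  apply/measurable_EFinP/measurableT_comp => //; exact: measurable_indic.
have p0 (q : TT) : 0 <= (\1_A (h q) : R)%:E by rewrite lee_fin.
have mF := @measurable_fun_fubini_tonelli_F _ _ _ _ _ (@halfline R) _ m1A p0.
have F0 p : 0 <= fubini_F (@halfline R) (fun q : TT => (\1_A (h q) : R)%:E) p.
  exact: integral_ge0.
split; first exact: (@measurable_fun_fubini_tonelli_G _ _ _ _ _ (@halfline R) _ mF F0).
rewrite -(@fubini_tonelli _ _ _ _ _ (@halfline R) P _ mF); last exact: F0.
apply: eq_integral => x _.
have mxz : measurable_fun setT (fun p : measurableTypeR R * T => (\1_A (h ((x, p.2), p.1)) : R)%:E).
  apply: (measurableT_comp m1A (g := fun p : measurableTypeR R * T => (((x, p.2), p.1) : TT))).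
  apply: measurable_fun_pair; last exact: measurable_fst.
  apply: measurable_fun_pair => //; exact: measurable_snd.
rewrite -(@fubini_tonelli _ _ _ _ _ (@halfline R) P _ mxz); last by move=> p; exact: p0.
apply: eq_integral => z _.
rewrite -[in RHS](setIT (_ @^-1` _)) -integral_indic//.
have mw : measurable_fun setT (fun w => h ((x, w), z)).
  apply: (measurableT_comp mh (g := fun w : T => (((x, w), z) : TT))).
  by apply: measurable_fun_pair => //; exact: measurable_fun_pair.
by rewrite -[X in measurable X]setTI; exact: mw.
Qed.

End expected_occupation.

(** * Differences of powers *)
Section power_differences.
Context (R : realType).
Implicit Types (a x y t h u : R).

Lemma powR_antitone a x y : a <= 0 -> 0 < x -> x <= y -> y `^ a <= x `^ a.
Proof.
move=> a0 x0 xy; have y0 := lt_le_trans x0 xy.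
rewrite -(opprK a) !(powRN _ (- a)) lef_pV2 ?posrE ?powR_gt0//.
by rewrite ge0_ler_powR ?nnegrE ?oppr_ge0// ltW.
Qed.

Lemma powR_mvt a x y : 0 < x -> x <= y ->
  exists2 c, x <= c <= y & y `^ a - x `^ a = a * c `^ (a - 1) * (y - x).
Proof.
move=> x0 xy.
have dp z : z \in `[x, y] -> is_derive z 1 (@powR R ^~ a) (a * z `^ (a - 1)).
  by rewrite in_itv/= => /andP[xz _]; apply: is_derive1_powR; exact: lt_le_trans xz.
have [c] := @MVT_segment R (@powR R ^~ a) (fun z => a * z `^ (a - 1)) x y xy
  (fun z zxy => dp z (subset_itv_oo_cc zxy))
  (derivable_within_continuous (fun z zxy => @ex_derive _ _ _ _ _ _ _ (dp z zxy))).
by rewrite in_itv/= => cxy E; exists c.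
Qed.

Lemma powR_diff_bounds a x y : 0 < a < 1 -> 0 < x -> x <= y ->
  a * y `^ (a - 1) * (y - x) <= y `^ a - x `^ a <= a * x `^ (a - 1) * (y - x).
Proof.
move=> /andP[a0 a1] x0 xy; have [c /andP[xc cy] ->] := powR_mvt a x0 xy.
have c0 := lt_le_trans x0 xc.
have am : a - 1 <= 0 by lra.
by rewrite !ler_wpM2r ?subr_ge0// ler_wpM2l ?(ltW a0)//; exact: powR_antitone.
Qed.

(** Mean value theorem twice: the second difference is
    a (1 - a) h u e^(a - 2) for some e between t - u and t + h. *)
Lemma powR_second_diff_bounds a t h u : 0 < a < 1 -> 0 < u -> u < t -> 0 < h ->
  a * (1 - a) * h * u * (t + h) `^ (a - 2) <=
  ((t + h - u) `^ a - (t - u) `^ a) - ((t + h) `^ a - t `^ a) <=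
  a * (1 - a) * h * u * (t - u) `^ (a - 2).
Proof.
move=> /andP[a0 a1] u0 ut h0.
(* the second difference is an increment of psi over [t - u, t] *)
pose psi y := (y + h) `^ a - y `^ a.
have tu : 0 < t - u by rewrite subr_gt0.
have dp z : z \in `[t - u, t] -> is_derive z 1 psi
    (a * (z + h) `^ (a - 1) - a * z `^ (a - 1)).
  rewrite in_itv/= => /andP[xz _]; have z0 : 0 < z := lt_le_trans tu xz.
  apply: is_deriveB; last exact: is_derive1_powR.
  have zh : 0 < z + h by rewrite addr_gt0.
  have d1 := is_derive1_powR a zh.
  have d2 : is_derive z 1 (fun y : R => y + h) 1.
    by apply: is_derive_eq; rewrite addr0.
  have := @is_derive1_comp R (@powR R ^~ a) (fun y => y + h) z _ _ d1 d2.
  by rewrite mulr1.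
have ttu : t - u <= t by rewrite gerBl ltW.
have [c] := @MVT_segment R psi _ (t - u) t ttu
  (fun z zxy => dp z (subset_itv_oo_cc zxy))
  (derivable_within_continuous (fun z zxy => @ex_derive _ _ _ _ _ _ _ (dp z zxy))).
rewrite in_itv/= => /andP[c1 c2] E.
have c0 : 0 < c := lt_le_trans tu c1.
have cch : c <= c + h by rewrite lerDl ltW.
have [e /andP[e1 e2] E2] := powR_mvt (a - 1) c0 cch.
have e0 : 0 < e := lt_le_trans c0 e1.
have -> : ((t + h - u) `^ a - (t - u) `^ a) - ((t + h) `^ a - t `^ a) =
    a * (1 - a) * h * u * e `^ (a - 2).
  have -> : t + h - u = t - u + h by ring.
  have := E; rewrite /psi -mulrBr E2.
  have -> : a - 1 - 1 = a - 2 by ring.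
  move: (e `^ (a - 2)) => w; lra.
have K0 : 0 <= a * (1 - a) * h * u.
  by rewrite !mulr_ge0 ?(ltW a0) ?(ltW h0) ?(ltW u0)// subr_ge0 ltW.
have am : a - 2 <= 0 by lra.
by rewrite !ler_wpM2l//; apply: powR_antitone => //; lra.
Qed.

End power_differences.

(** * Integrals against a measure with a power distribution function *)
Section sigma_finite_copy.
Context d (T : measurableType d) (R : realType) (mu : {measure set T -> \bar R}).

(** A copy of [mu] that carries the structure of a sigma-finite measure: here
    sigma-finiteness is a consequence of hypotheses on [mu], and cannot be
    attached to [mu] itself. *)
Definition sigma_finite_copy of sigma_finite setT mu : set T -> \bar R := mu.

Hypothesis sf : sigma_finite setT mu.
HB.instance Definition _ := Measure.on (sigma_finite_copy sf).
HB.instance Definition _ := Measure_isSigmaFinite.Build _ _ _ (sigma_finite_copy sf) sf.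

End sigma_finite_copy.

Lemma fubini_sections d1 d2 (T1 : measurableType d1) (T2 : measurableType d2)
    (R : realType) (m1 : {sigma_finite_measure set T1 -> \bar R})
    (m2 : {sigma_finite_measure set T2 -> \bar R}) (B : set (T1 * T2)) :
  measurable B ->
  (\int[m1]_u m2 (xsection B u) = \int[m2]_v m1 (ysection B v))%E.
Proof.
move=> mB; have := indic_fubini_tonelli m1 m2 mB.
have -> : fubini_F m2 (EFin \o \1_B) = m2 \o xsection B by exact: indic_fubini_tonelli_FE.
by have -> : fubini_G m1 (EFin \o \1_B) = m1 \o ysection B by exact: indic_fubini_tonelli_GE.
Qed.

Lemma measurable_powR_sub (R : realType) (c a : R) (A : set R) :
  measurable_fun A (fun u : R => (c - u) `^ a).
Proof.
apply: measurable_funTS.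
have m : measurable_fun setT (fun u : R => c - u).
  by apply: measurable_funB => //; exact: measurable_id.
exact: (measurableT_comp (measurable_powR a) m).
Qed.

Section power_law_measure.
Context (R : realType) (mu : {measure set R -> \bar R}) (alpha C : R).
Hypothesis alpha01 : 0 < alpha < 1.
Hypothesis C0 : 0 < C.
Hypothesis mu_neg : mu `]-oo, 0[%classic = 0%E.
Hypothesis muC : forall t : R, 0 < t -> mu `]-oo, t]%classic = (C * t `^ alpha)%:E.

Lemma measurable_band (a b c e : R) : measurable (band a b c e).
Proof.
have m1 : measurable_fun setT (fun u : R * R => u.1) by exact: measurable_fst.
have m2 : measurable_fun setT (fun u : R * R => (u.1 + u.2)%R).
  by apply: measurable_funD => //; exact: measurable_snd.
rewrite (_ : band a b c e = (fst @^-1` `]a, b]%classic) `&`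
   ((fun u : R * R => (u.1 + u.2)%R) @^-1` `]c, e]%classic)).
  by apply: measurableI; rewrite -[X in measurable X]setTI; [exact: m1|exact: m2].
by apply/seteqP; split => u; rewrite /band /= !in_itv.
Qed.

Local Open Scope ereal_scope.

Lemma potential_neg (A : set R) : measurable A -> A `<=` `]-oo, 0%R[%classic -> mu A = 0.
Proof.
move=> mA A0; apply/eqP; rewrite eq_le measure_ge0 andbT.
rewrite -mu_neg; apply: le_measure; rewrite ?inE//.
Qed.

Lemma potential_split (a b : R) : (a <= b)%R ->
  mu `]-oo, b]%classic = mu `]-oo, a]%classic + mu `]a, b]%classic.
Proof.
move=> ab; rewrite -measureU//.
  congr (mu _); apply/seteqP; split => x /=; rewrite !in_itv/=.
    by move=> xb; case: (leP x a) => xa; [left|right].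
  by case=> [xa|/andP[]//]; exact: le_trans ab.
apply/seteqP; split => // x [] /=; rewrite !in_itv/= => xa /andP[].
by rewrite ltNge xa.
Qed.

Lemma potential_itv (a b : R) : (0 < a)%R -> (a <= b)%R ->
  mu `]a, b]%classic = (C * (b `^ alpha - a `^ alpha))%:E.
Proof.
move=> a0 ab; have b0 := lt_le_trans a0 ab.
have := potential_split ab; rewrite !muC// => E.
have fin : mu `]a, b]%classic \is a fin_num.
  by move: E; case: (mu _).
by move: E; rewrite -(fineK fin) -EFinD => -[E]; congr EFin; rewrite mulrBr E; ring.
Qed.

Lemma potential_itv_from_neg (a b : R) : (a < 0)%R -> (0 < b)%R ->
  mu `]a, b]%classic = (C * b `^ alpha)%:E.
Proof.
move=> a0 b0; rewrite -muC// (@potential_split a b) ?(ltW (lt_trans a0 b0))//.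
rewrite (_ : mu `]-oo, a]%classic = 0) ?add0e//; apply: potential_neg.
  exact: measurable_itv.
by move=> x /=; rewrite !in_itv/= => xa; exact: le_lt_trans a0.
Qed.

Lemma potential_sigma_finite : sigma_finite setT mu.
Proof.
exists (fun n => `]-oo, n.+1%:R]%classic).
  apply/esym/seteqP; split => // x _; exists (Num.truncn x) => //=.
  by rewrite in_itv/= ltW// truncnS_gt.
by move=> n; split; [exact: measurable_itv|rewrite muC ?ltry].
Qed.

Let mu' : {sigma_finite_measure set R -> \bar R} := sigma_finite_copy potential_sigma_finite.

Lemma measurable_potential_xsection (B : set (R * R)) : measurable B ->
  measurable_fun setT (fun u => mu (xsection B u)).
Proof. by move=> mB; exact: (measurable_fun_xsection mu' mB). Qed.

Lemma measurable_potential_ysection (B : set (R * R)) : measurable B ->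
  measurable_fun setT (fun u => mu (ysection B u)).
Proof. by move=> mB; exact: (measurable_fun_ysection mu' mB). Qed.

Lemma potential_double_swap (B : set (R * R)) : measurable B ->
  \int[mu]_u mu (xsection B u) = \int[mu]_v mu (ysection B v).
Proof.
by move=> mB; exact: (fubini_sections mu' mu' mB).
Qed.

(** The sections are contained in ]-oo, t + 1], whose measure is finite. *)
Lemma potential_double_lty (t : R) : (0 < t)%R ->
  \int[mu]_u mu (xsection (band (-1)%R t (-1)%R t) u) < +oo.
Proof.
move=> t0.
have le1 : \int[mu]_u mu (xsection (band (-1)%R t (-1)%R t) u) <=
    \int[mu]_(u in `](-1)%R, t]%classic) (cst (mu `]-oo, (t + 1)%R]%classic) u).
  rewrite [leRHS]integral_mkcond; apply: ge0_le_integral => //.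
  - by apply: measurable_potential_xsection; exact: measurable_band.
  - by apply/(measurable_restrictT _ _).1.
  - move=> u _; rewrite patchE mem_setE; case: ifPn; rewrite in_itv/= => uab.
      apply: le_measure; rewrite ?inE//.
    by apply: measurable_xsection; exact: measurable_band.
      move=> v; rewrite /xsection /= in_setE /band /= in_itv/=.
      by move=> [_ /andP[_]]; have /andP[] := uab; lra.
    rewrite (_ : xsection _ _ = set0) ?measure0//; apply/seteqP; split => v //.
    by rewrite /xsection /= in_setE /band /= (negbTE uab) => -[].
apply: (le_lt_trans le1).
rewrite integral_cst// muC ?addr_gt0// potential_itv_from_neg// ?ltrN10//.
by rewrite -EFinM ltry.
Qed.

(** The integrand is the increment of the distribution function from t - u to
    t + h - u; subtracting its value at u = 0 leaves a second difference, which
    is proportional to u up to a power that hardly depends on u. *)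
Lemma potential_cross_bounds (s h t : R) : (0 < s)%R -> (0 < h)%R -> (s + h < t)%R ->
  let I := \int[mu]_(u in `]s, (s + h)%R]%classic) u%:E in
  let K := (C * (alpha * (1 - alpha) * h))%R in
  let g2 := (C * ((s + h) `^ alpha - s `^ alpha) * (C * ((t + h) `^ alpha - t `^ alpha)))%R in
  let E := \int[mu]_(u in `]s, (s + h)%R]%classic) mu `](t - u)%R, (t + h - u)%R]%classic in
  g2%:E + (K * (t + h) `^ (alpha - 2))%:E * I <= E /\
  E <= g2%:E + (K * (t - (s + h)) `^ (alpha - 2))%:E * I.
Proof.
move=> s0 h0 sht I K g2 E.
have ssh : (s <= s + h)%R by rewrite lerDl ltW.
have tth : (t <= t + h)%R by rewrite lerDl ltW.
have t0 : (0 < t)%R by lra.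
have K0 : (0 <= K)%R by have /andP[a0 a1] := alpha01; rewrite /K !mulr_ge0 ?(ltW C0) ?(ltW h0) ?(ltW a0)// subr_ge0 ltW.
have g0 : (0 <= C * ((t + h) `^ alpha - t `^ alpha))%R.
  have /andP[H _] := powR_diff_bounds alpha01 t0 tth.
  rewrite mulr_ge0// ?(ltW C0)// (le_trans _ H)// mulr_ge0 ?mulr_ge0 ?powR_ge0//; try lra.
  by have /andP[a0 a1] := alpha01; lra.
have EE : E = \int[mu]_(u in `]s, (s + h)%R]%classic)
    (C * ((t + h - u) `^ alpha - (t - u) `^ alpha))%:E.
  apply: eq_integral => u; rewrite mem_setE/= in_itv/= => /andP[su ush].
  by rewrite potential_itv//; lra.
have mlin k : measurable_fun `]s, (s + h)%R]%classic
    (fun u : R => (C * ((t + h) `^ alpha - t `^ alpha))%:E + k%:E * u%:E).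
  apply: emeasurable_funD => //; apply: measurable_funeM.
  by apply/measurable_EFinP; exact: measurable_id.
have lin k : (0 <= k)%R -> \int[mu]_(u in `]s, (s + h)%R]%classic)
    ((C * ((t + h) `^ alpha - t `^ alpha))%:E + k%:E * u%:E) = g2%:E + k%:E * I.
  move=> k0; rewrite ge0_integralD//; last 2 first.
  - move=> u; rewrite /= in_itv/= => /andP[su _]; rewrite mule_ge0// lee_fin; lra.
  - by apply: measurable_funeM; apply/measurable_EFinP; exact: measurable_id.
  rewrite integral_cst// potential_itv// -EFinM ge0_integralZl//; last first.
    by move=> u; rewrite /= in_itv/= => /andP[su _]; rewrite lee_fin; lra.
  by rewrite mulrC.
have mE : measurable_fun `]s, (s + h)%R]%classic
   (fun u : R => (C * ((t + h - u) `^ alpha - (t - u) `^ alpha))%:E).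
  apply/measurable_EFinP; apply: measurable_funM => //.
  by apply: measurable_funB; exact: measurable_powR_sub.
have key u : (s < u)%R -> (u <= s + h)%R ->
    (K * u * (t + h) `^ (alpha - 2) + C * ((t + h) `^ alpha - t `^ alpha) <=
     C * ((t + h - u) `^ alpha - (t - u) `^ alpha) <=
     K * u * (t - (s + h)) `^ (alpha - 2) + C * ((t + h) `^ alpha - t `^ alpha))%R.
  move=> su ush.
  have u0 : (0 < u)%R by lra.
  have ut : (u < t)%R by lra.
  have := powR_second_diff_bounds alpha01 u0 ut h0.
  have : ((t - u) `^ (alpha - 2) <= (t - (s + h)) `^ (alpha - 2))%R.
    by have /andP[a0 a1] := alpha01; apply: powR_antitone; lra.
  rewrite /K; set A := ((t - u) `^ (alpha - 2))%R; set B := (_ `^ (alpha - 2))%R => AB.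
  set Z := ((t + h) `^ (alpha - 2))%R.
  set X := (_ - _ - _)%R => /andP[H1 H2].
  have KK : (0 <= alpha * (1 - alpha) * h * u)%R.
    by have /andP[a0 a1] := alpha01; rewrite !mulr_ge0 ?(ltW u0) ?(ltW h0) ?(ltW a0)// subr_ge0 ltW.
  have H3 : (X <= alpha * (1 - alpha) * h * u * B)%R.
    by apply: (le_trans H2); rewrite ler_wpM2l.
  have := ler_wpM2l (ltW C0) H1; have := ler_wpM2l (ltW C0) H3.
  rewrite /X => ? ?; apply/andP; split; lra.
have kge0 x : (0 <= K * x `^ (alpha - 2))%R by rewrite mulr_ge0// powR_ge0.
split.
  rewrite -(lin _ (kge0 _)) EE; apply: ge0_le_integral => //.
  - move=> u; rewrite /= in_itv/= => /andP[su _].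
    apply: adde_ge0; first by rewrite lee_fin.
    apply: mule_ge0; rewrite lee_fin; first exact: kge0.
    by rewrite ltW// (lt_trans s0).
  - move=> u; rewrite /= in_itv/= => /andP[su ush].
    rewrite -EFinM -EFinD lee_fin; have /andP[H _] := key u su ush; lra.
rewrite -(lin _ (kge0 _)) EE; apply: ge0_le_integral => //.
- move=> u; rewrite /= in_itv/= => /andP[su ush].
  rewrite lee_fin; have /andP[H _] := key u su ush; apply: le_trans H.
  apply: addr_ge0 => //; apply: mulr_ge0; last exact: powR_ge0.
  by apply: mulr_ge0 => //; lra.
- move=> u; rewrite /= in_itv/= => /andP[su ush].
  rewrite -EFinM -EFinD lee_fin; have /andP[_ H] := key u su ush; lra.
Qed.

(** Integrating in the other order, the section at v is ]t, t + h - v], and its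
    measure is a first difference of the distribution function. *)
Lemma potential_square_bounds (h t : R) : (0 < h)%R -> (0 < t)%R ->
  let L := \int[mu]_(v in `[0%R, h]%classic) (h - v)%:E in
  let E := \int[mu]_u mu (xsection (band t (t + h)%R t (t + h)%R) u) in
  (C * alpha * (t + h) `^ (alpha - 1))%:E * L <= E /\
  E <= (C * alpha * t `^ (alpha - 1))%:E * L.
Proof.
move=> h0 t0 L E.
have tth : (t <= t + h)%R by rewrite lerDl ltW.
have EE : E = \int[mu]_(v in `[0%R, h]%classic)
    (C * ((t + h - v) `^ alpha - t `^ alpha))%:E.
  rewrite /E potential_double_swap; last exact: measurable_band.
  have mB := measurable_band t (t + h) t (t + h).
  rewrite (@ge0_negligible_integral _ _ _ mu setT `]-oo, 0%R[%classic)//; last exact: measurable_potential_ysection.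
  rewrite integral_mkcond [RHS]integral_mkcond.
  apply: eq_integral => v _; rewrite !patchE setTD in_setC !mem_setE.
  rewrite !in_itv/= -leNgt; case: ifPn => v0 //=; case: ifPn => vh.
    rewrite -potential_itv//; last lra.
    congr (mu _); apply/seteqP; split => u;
      rewrite /ysection /= in_setE /band /= in_itv/=.
      by move=> [/andP[-> _] /andP[_]]; lra.
    by move=> /andP[tu ?]; split; apply/andP; split; lra.
  rewrite (_ : ysection _ _ = set0) ?measure0//; apply/seteqP; split => u //.
  rewrite /ysection /= in_setE /band /= => -[/andP[? ?] /andP[? ?]].
  by rewrite -ltNge in vh; lra.
have mlin : measurable_fun `[0%R, h]%classic (fun v : R => (h - v)%:E).
  by apply/measurable_funTS/measurable_EFinP; apply: measurable_funB.
have mE : measurable_fun `[0%R, h]%classic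
   (fun v : R => (C * ((t + h - v) `^ alpha - t `^ alpha))%:E).
  apply/measurable_EFinP; apply: measurable_funM => //.
  by apply: measurable_funB => //; exact: measurable_powR_sub.
have lin k : (0 <= k)%R -> \int[mu]_(v in `[0%R, h]%classic) (k%:E * (h - v)%:E) = k%:E * L.
  move=> k0; rewrite ge0_integralZl//.
  by move=> v; rewrite /= in_itv/= => /andP[_ vh]; rewrite lee_fin subr_ge0.
have /andP[a0 a1] := alpha01.
have key v : (0 <= v)%R -> (v <= h)%R ->
    (C * alpha * (t + h) `^ (alpha - 1) * (h - v) <=
     C * ((t + h - v) `^ alpha - t `^ alpha) <=
     C * alpha * t `^ (alpha - 1) * (h - v))%R.
  move=> v0 vh.
  have tthv : (t <= t + h - v)%R by lra.
  have := powR_diff_bounds alpha01 t0 tthv.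
  have : ((t + h) `^ (alpha - 1) <= (t + h - v) `^ (alpha - 1))%R by apply: powR_antitone; lra.
  set A := (_ `^ (alpha - 1))%R; set B := (_ `^ (alpha - 1))%R; set Z := (_ `^ (alpha - 1))%R.
  have -> : (t + h - v - t = h - v)%R by ring.
  set X := ((t + h - v) `^ alpha - t `^ alpha)%R => AB /andP[H1 H2].
  have H3 : (alpha * A * (h - v) <= X)%R.
    apply: (le_trans _ H1); rewrite ler_wpM2r ?subr_ge0// ler_wpM2l//; lra.
  have := ler_wpM2l (ltW C0) H3; have := ler_wpM2l (ltW C0) H2.
  by rewrite !mulrA => ? ?; apply/andP.
have k0 x : (0 <= C * alpha * x `^ (alpha - 1))%R.
  by rewrite !mulr_ge0 ?powR_ge0 ?(ltW C0) ?(ltW a0).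
split; rewrite -lin// EE; apply: ge0_le_integral => //.
- move=> v; rewrite /= in_itv/= => /andP[v0 vh].
  by rewrite mule_ge0 ?lee_fin// subr_ge0.
- exact: measurable_funeM.
- move=> v; rewrite /= in_itv/= => /andP[v0 vh].
  by rewrite -EFinM lee_fin; have /andP[] := key v v0 vh.
- move=> v; rewrite /= in_itv/= => /andP[v0 vh].
  rewrite lee_fin; have /andP[H _] := key v v0 vh; apply: le_trans H.
  by rewrite mulr_ge0// subr_ge0.
- exact: measurable_funeM.
- move=> v; rewrite /= in_itv/= => /andP[v0 vh].
  by rewrite -EFinM lee_fin; have /andP[] := key v v0 vh.
Qed.

Lemma integral_potential_id_bounds (s h : R) : (0 < s)%R -> (0 < h)%R ->
  exists2 I : R, (0 < I)%R & \int[mu]_(u in `]s, (s + h)%R]%classic) u%:E = I%:E.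
Proof.
move=> s0 h0.
have ssh : (s <= s + h)%R by rewrite lerDl ltW.
have mid : measurable_fun `]s, (s + h)%R]%classic (fun u : R => u%:E).
  by apply/measurable_EFinP; exact: measurable_id.
have /andP[a0 a1] := alpha01.
have U0 : (0 < C * ((s + h) `^ alpha - s `^ alpha))%R.
  have /andP[H _] := powR_diff_bounds alpha01 s0 ssh.
  apply: mulr_gt0 => //; apply: (lt_le_trans _ H).
  by rewrite !mulr_gt0 ?powR_gt0//; lra.
have up : \int[mu]_(u in `]s, (s + h)%R]%classic) u%:E <=
    \int[mu]_(u in `]s, (s + h)%R]%classic) (cst (s + h)%:E u).
  apply: ge0_le_integral => //.
  - by move=> u; rewrite /= in_itv/= => /andP[su _]; rewrite lee_fin; lra.
  - by move=> u; rewrite /= in_itv/= => /andP[_ ush]; rewrite lee_fin.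
have lo : \int[mu]_(u in `]s, (s + h)%R]%classic) (cst s%:E u) <=
    \int[mu]_(u in `]s, (s + h)%R]%classic) u%:E.
  apply: ge0_le_integral => //.
  - by move=> u _; rewrite lee_fin ltW.
  - by move=> u; rewrite /= in_itv/= => /andP[su _]; rewrite lee_fin ltW.
rewrite integral_cst// potential_itv// -EFinM in up.
rewrite integral_cst// potential_itv// -EFinM in lo.
move: up lo; set J := (X in X <= _) => up lo.
have finJ : J \is a fin_num.
  rewrite ge0_fin_numE; first by rewrite (le_lt_trans up)// ltry.
  by apply: le_trans lo; rewrite lee_fin mulr_ge0 ?ltW.
exists (fine J); last by rewrite fineK.
rewrite -lte_fin fineK//; apply: lt_le_trans lo; rewrite lte_fin mulr_gt0//.
Qed.

Lemma integral_potential_triangle_fin (h : R) : (0 < h)%R ->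
  exists2 L : R, (0 <= L)%R & \int[mu]_(v in `[0%R, h]%classic) (h - v)%:E = L%:E.
Proof.
move=> h0.
have mid : measurable_fun `[0%R, h]%classic (fun v : R => (h - v)%:E).
  by apply/measurable_EFinP; apply: measurable_funB => //; exact: measurable_id.
have J0 : 0 <= \int[mu]_(v in `[0%R, h]%classic) (h - v)%:E.
  by apply: integral_ge0 => v; rewrite /= in_itv/= => /andP[_ vh]; rewrite lee_fin subr_ge0.
have up : \int[mu]_(v in `[0%R, h]%classic) (h - v)%:E <=
    \int[mu]_(v in `]-oo, h]%classic) (cst h%:E v).
  apply: (@le_trans _ _ (\int[mu]_(v in `[0%R, h]%classic) (cst h%:E v))).
    apply: ge0_le_integral => //.
    - by move=> u; rewrite /= in_itv/= => /andP[_ su]; rewrite lee_fin; lra.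
    - by move=> u; rewrite /= in_itv/= => /andP[u0 ush]; rewrite lee_fin; lra.
  apply: ge0_subset_integral => //.
    by move=> u _; rewrite lee_fin ltW.
  by move=> u; rewrite /= !in_itv/= => /andP[].
rewrite integral_cst// muC// -EFinM in up.
move: up J0; set J := (X in X <= _) => up J0.
have finJ : J \is a fin_num by rewrite ge0_fin_numE// (le_lt_trans up)// ltry.
by exists (fine J); [exact: fine_ge0|rewrite fineK].
Qed.

End power_law_measure.

(** * Moments of the inverse subordinator *)
Section passage_moments.
Context (R : realType) d (T : measurableType d) (P : probability T R).
Context (alpha : R) (D : R -> T -> R).
Hypothesis SD : stable_subordinator P alpha D.
Let LD := stable_levy SD.
Local Notation U := (subordinator_potential SD).
Definition passage (t : R) (w : T) : R := first_passage (D ^~ w) t.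
Local Notation Y := passage.

(** By right-continuity the first passage is decided at dyadic times.  The event
    that the level is never exceeded, where the infimum is 0, is treated
    apart. *)
Lemma measurable_passage t : measurable_fun setT (Y t).
Proof.
have mD := levy_measurable LD.
have mgt q : 0 <= q -> measurable [set w | t < D q w].
  move=> q0; rewrite -[X in measurable X]setTI.
  by apply: measurable_fun_ltr => //; exact: mD.
move=> mT; apply: (measurability _ (RGenInftyO.measurableE R)) => // _ [_ [y ->] <-].
rewrite setTI.
pose S w := [set x : R | 0 < x /\ t < D x w].
have lbS w : has_lbound (S w) by exists 0 => x [/ltW].
(* A: the level is exceeded before y; E: it is never exceeded *)
pose A := \bigcup_(n : nat) \bigcup_(i in [set i | 0 < (dyadic n i : R) < y])
   [set w | t < D (dyadic n i) w].
pose E := ~` \bigcup_(n : nat) \bigcup_(i in [set i | 0 < dyadic n i :> R])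
   [set w | t < D (dyadic n i) w].
have right w x : 0 < x -> t < D x w -> forall z, x < z ->
    exists n i, 0 < (dyadic n i : R) < z /\ t < D (dyadic n i) w.
  move=> x0 tx z xz.
  have [rc _] := levy_cadlag LD w (ltW x0).
  have H1 : \forall n \near \oo, t < D (dyadic_above n x) w.
    exact: (cvg_comp _ _ (cvg_dyadic_above (ltW x0)) rc) (lt_nbhsr tx).
  have H2 : \forall n \near \oo, dyadic_above n x < z.
    exact: cvg_dyadic_above (ltW x0) _ (nbhs_right_lt xz).
  near \oo => n; exists n, (dyadic_index n x); split; last by near: n.
  apply/andP; split; last by near: n.
  exact: lt_trans x0 (dyadic_above_gt n (ltW x0)).
have -> : Y t @^-1` `]-oo, y[ = A `|` (if 0 < y then E else set0).
  apply/seteqP; split => w /=.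
    rewrite in_itv/= => Yy; have [S0|S0] := pselect (S w !=set0).
      left; have [x [x0 tx] xy] := inf_lt S0 Yy.
      have [n [i [H1 H2]]] := right w x x0 tx y xy.
      by exists n => //; exists i.
    right; have Y0 : Y t w = 0.
      rewrite /passage /first_passage (_ : [set x | _] = set0) ?inf0//.
      by apply/seteqP; split => // x Sx; case: S0; exists x.
    rewrite Y0 in Yy; rewrite Yy => -[n _ [i /= i0 ti]]; apply: S0.
    by exists (dyadic n i).
  case.
    move=> [n _ [i /= /andP[i0 iy] ti]]; rewrite in_itv/=.
    by apply: le_lt_trans iy; apply: (ge_inf (lbS w)); split.
  case: ifPn => // y0 Ew; rewrite in_itv/=.
  rewrite /passage /first_passage (_ : [set x | _] = set0) ?inf0//.
  apply/seteqP; split => // x [x0 tx].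
  have xx1 : x < x + 1 by rewrite ltrDl.
  have [n [i [/andP[H1 _] H2]]] := right w x x0 tx (x + 1) xx1.
  by apply: Ew; exists n => //; exists i.
apply: measurableU.
  apply: bigcupT_measurable => n; apply: bigcup_measurable => i _.
  by apply: mgt; exact: dyadic_ge0.
case: ifPn => // _; apply: measurableC.
apply: bigcupT_measurable => n; apply: bigcup_measurable => i _.
by apply: mgt; exact: dyadic_ge0.
Unshelve. all: by end_near.
Qed.

Let good w := diverging_path (D ^~ w).
Let aegood : {ae P, forall w, good w} := subordinator_diverging SD.
Let mpath w : measurable_fun [set: measurableTypeR R] (fun x : measurableTypeR R => D (Num.max 0 x) w).
Proof.
have := measurable_subordinator_eval SD => /(@measurable_fun_pair1 _ _ _ (measurableTypeR R) T R _ w).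
exact.
Qed.

Lemma passage_mono : {ae P, forall w, forall s t, s <= t -> Y s w <= Y t w}.
Proof. by apply: filterS aegood => w gw s t; exact: first_passage_homo. Qed.

Lemma passage_lt0 t : t < 0 -> {ae P, forall w, Y t w = 0}.
Proof. by move=> t0; apply: filterS aegood => w gw; exact: first_passage_lt0. Qed.

Local Open Scope ereal_scope.

Lemma integral_passage_diff (a b : R) : (a <= b)%R ->
  \int[P]_w (Y b w - Y a w)%:E = U `]a, b]%classic.
Proof.
move=> ab; have [mO <-] := expected_occupation SD (@measurable_itv R `]a, b]).
apply: ae_eq_integral => //.
  by apply/measurable_EFinP; apply: measurable_funB; exact: measurable_passage.
apply: filterS aegood => w gw _.
by rewrite (halfline_occupation gw (mpath w) ab).
Qed.

Lemma integral_passage_prod (a b c e : R) : (a <= b)%R -> (b <= c)%R -> (c <= e)%R ->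
  \int[P]_w ((Y b w - Y a w) * (Y e w - Y c w))%:E =
  \int[U]_(u in `]a, b]) U `](c - u)%R, (e - u)%R]%classic.
Proof.
move=> ab bc ce; transitivity (\int[U]_u U (xsection (band a b c e) u)).
  have [mO <-] := expected_double_occupation SD (measurable_band a b c e).
  apply: ae_eq_integral => //.
    by apply/measurable_EFinP; apply: measurable_funM; apply: measurable_funB;
      exact: measurable_passage.
  apply: filterS aegood => w gw _.
  by rewrite (double_occupation_prod gw (mpath w)).
rewrite [RHS]integral_mkcond; apply: eq_integral => u _.
rewrite patchE mem_setE; case: ifPn; rewrite in_itv/= => uab.
  congr (U _); apply/seteqP; split => v; rewrite /xsection /= in_setE /band /= in_itv/=.
    by move=> [_]; rewrite ltrBlDl lerBrDl.
  by rewrite ltrBlDl lerBrDl.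
rewrite (_ : xsection _ _ = set0) ?measure0//; apply/seteqP; split => v //.
by rewrite /xsection /= in_setE /band /= (negbTE uab) => -[].
Qed.

Lemma integral_passage_square (a b : R) : (a <= b)%R ->
  \int[P]_w ((Y b w - Y a w) ^+ 2 / 2)%:E =
  \int[U]_u U (xsection (band a b a b) u).
Proof.
move=> ab.
have [mO <-] := expected_double_occupation SD (measurable_band a b a b).
apply: ae_eq_integral => //.
  apply/measurable_EFinP; apply: measurable_funM => //; apply: measurable_funX.
  by apply: measurable_funB; exact: measurable_passage.
apply: filterS aegood => w gw _.
by rewrite (double_occupation_square gw (mpath w)).
Qed.

Hypothesis alpha01 : (0 < alpha < 1)%R.
Variable C : R.
Hypothesis C0 : (0 < C)%R.
Hypothesis UC : forall t : R, (0 < t)%R -> U `]-oo, t]%classic = (C * t `^ alpha)%:E.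
Let Uneg := subordinator_potential_neg SD.

Lemma integral_passage (t : R) : (0 < t)%R ->
  \int[P]_w (Y t w)%:E = (C * t `^ alpha)%:E.
Proof.
move=> t0.
rewrite -(potential_itv_from_neg Uneg UC (ltrN10 R) t0) -[RHS]integral_passage_diff; last first.
  by rewrite (le_trans _ (ltW t0))// lerN10.
apply: ae_eq_integral => //.
- by apply/measurable_EFinP; exact: measurable_passage.
- by apply/measurable_EFinP; apply: measurable_funB; exact: measurable_passage.
- by apply: filterS (passage_lt0 (ltrN10 R)) => w -> _; rewrite subr0.
Qed.

Lemma integral_passage_square_lty (t : R) : (0 < t)%R ->
  \int[P]_w (Y t w ^+ 2)%:E < +oo.
Proof.
move=> t0.
have t1 : (-1 <= t)%R by rewrite (le_trans _ (ltW t0))// lerN10.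
have mY2 : measurable_fun setT (fun w => Y t w ^+ 2)%R.
  by apply: measurable_funX; exact: measurable_passage.
have H : \int[P]_w (Y t w ^+ 2 / 2)%:E < +oo.
  rewrite (_ : \int[P]_w _ = \int[P]_w ((Y t w - Y (-1)%R w) ^+ 2 / 2)%:E).
    by have := potential_double_lty Uneg UC t0; rewrite -integral_passage_square.
  apply: ae_eq_integral => //.
  - by apply/measurable_EFinP; apply: measurable_funM.
  - apply/measurable_EFinP; apply: measurable_funM => //; apply: measurable_funX.
    by apply: measurable_funB; exact: measurable_passage.
  - by apply: filterS (passage_lt0 (ltrN10 R)) => w -> _; rewrite subr0.
have : \int[P]_w (2%:E * (Y t w ^+ 2 / 2)%:E) < +oo.
  rewrite ge0_integralZl//.
  - by rewrite lte_mul_pinfty.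
  - by apply/measurable_EFinP; apply: measurable_funM.
  - by move=> w _; rewrite lee_fin divr_ge0// sqr_ge0.
by under eq_integral do rewrite -EFinM mulrC divfK//.
Qed.

(** The constant [g2] is the product of the expectations of the two increments,
    so that these are bounds for their covariance. *)
Lemma passage_cross_bounds (s h : R) : (0 < s)%R -> (0 < h)%R ->
  exists2 I, (0 < I)%R & forall t, (s + h < t)%R ->
  let E := \int[P]_w ((Y (s + h)%R w - Y s w) * (Y (t + h)%R w - Y t w))%:E in
  let K := (C * (alpha * (1 - alpha) * h))%R in
  let g2 := (C * ((s + h) `^ alpha - s `^ alpha) * (C * ((t + h) `^ alpha - t `^ alpha)))%R in
  (g2 + K * (t + h) `^ (alpha - 2) * I)%:E <= E /\
  E <= (g2 + K * (t - (s + h)) `^ (alpha - 2) * I)%:E.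
Proof.
move=> s0 h0; have [I I0 IE] := integral_potential_id_bounds alpha01 C0 UC s0 h0.
exists I => // t sht E K g2.
have [B1 B2] := potential_cross_bounds alpha01 C0 UC s0 h0 sht.
move: B1 B2; rewrite /= [X in (_ * X)%E]IE => B1; rewrite [X in (_ * X)%E]IE.
move: B1; rewrite -!EFinM -!EFinD => B1 B2.
have -> : E = \int[U]_(u in `]s, (s + h)%R]%classic)
    U `](t - u)%R, (t + h - u)%R]%classic.
  by rewrite /E integral_passage_prod ?lerDl ?ltW.
by [].
Qed.

Lemma passage_square_bounds (h : R) : (0 < h)%R ->
  exists2 L, (0 <= L)%R & forall t, (0 < t)%R ->
  let E := \int[P]_w ((Y (t + h)%R w - Y t w) ^+ 2 / 2)%:E in
  (C * alpha * (t + h) `^ (alpha - 1) * L)%:E <= E /\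
  E <= (C * alpha * t `^ (alpha - 1) * L)%:E.
Proof.
move=> h0; have [L L0 LE] := integral_potential_triangle_fin UC h0.
exists L => // t t0 E.
have [B1 B2] := potential_square_bounds alpha01 C0 Uneg UC h0 t0.
move: B1 B2; rewrite /= [X in (_ * X)%E]LE => B1; rewrite [X in (_ * X)%E]LE.
move: B1; rewrite -!EFinM => B1 B2.
by rewrite /E integral_passage_square ?lerDl ?(ltW h0).
Qed.

End passage_moments.

(** * Integrals of functions of independent pairs *)
Section independent_maps.
Context (R : realType) d (T : measurableType d) (P : probability T R).
Context d1 (T1 : measurableType d1) d2 (T2 : measurableType d2).
Context (f : T -> T1) (g : T -> T2).
Hypothesis mf : measurable_fun setT f.
Hypothesis mg : measurable_fun setT g.
Hypothesis fg : forall A B, measurable A -> measurable B ->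
  P (f @^-1` A `&` g @^-1` B) = (P (f @^-1` A) * P (g @^-1` B))%E.

(** Fubini's theorem for the joint law of independent maps: the second variable
    may be replaced by an independent copy and integrated out first.  Applied to
    the identity maps from the sample space to itself with two independent
    sigma-algebras, it is how one conditions on a process. *)
Lemma integral_independent_pair (H : T1 * T2 -> \bar R) :
  measurable_fun setT H -> (forall p, (0 <= H p)%E) ->
  (\int[P]_w H (f w, g w) = \int[P]_w \int[P]_v H (f w, g v))%E.
Proof.
move=> mH H0.
have mpair : measurable_fun setT (fun w => (f w, g w)) by exact: measurable_fun_pair.
pose F : {RV P >-> T1} := HB.pack f (isMeasurableFun.Build _ _ _ _ _ mf).
pose G : {RV P >-> T2} := HB.pack g (isMeasurableFun.Build _ _ _ _ _ mg).
pose Z : {RV P >-> (T1 * T2)%type} := HB.pack (fun w => (f w, g w))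
  (isMeasurableFun.Build _ _ _ _ _ mpair).
transitivity (\int[distribution P Z]_p H p)%E.
  by rewrite ge0_integral_distribution.
transitivity (\int[distribution P F \x distribution P G]_p H p)%E.
  apply: eq_measure_integral => A mA _.
  by apply/esym; apply: product_measure_unique => // B C mB mC; rewrite -fg.
rewrite fubini_tonelli1//= ge0_integral_distribution//=.
- by apply: eq_integral => w _; rewrite /fubini_F ge0_integral_distribution//;
    exact: measurableT_comp mH (measurable_pair1 _).
- exact: measurable_fun_fubini_tonelli_F.
- by move=> x; exact: integral_ge0.
Qed.

Lemma measurable_independent_section (H : T1 * T2 -> \bar R) :
  measurable_fun setT H -> (forall p, (0 <= H p)%E) ->
  measurable_fun setT (fun w => \int[P]_v H (f w, g v))%E.
Proof.
move=> mH H0.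
pose G : {RV P >-> T2} := HB.pack g (isMeasurableFun.Build _ _ _ _ _ mg).
have := measurable_fun_fubini_tonelli_F (m2 := distribution P G) _ mH H0.
move=> /measurableT_comp /(_ mf); apply: eq_measurable_fun => w _ /=.
by rewrite /fubini_F ge0_integral_distribution//;
    exact: measurableT_comp mH (measurable_pair1 _).
Qed.

End independent_maps.

Section independent_product.
Context (R : realType) d (T : measurableType d) (P : probability T R).

Lemma integral_independent_prod (f g : T -> R) :
  measurable_fun setT f -> measurable_fun setT g ->
  (forall w, 0 <= f w) -> (forall w, 0 <= g w) ->
  (forall A B, measurable A -> measurable B ->
    P (f @^-1` A `&` g @^-1` B) = (P (f @^-1` A) * P (g @^-1` B))%E) ->
  (\int[P]_w (f w * g w)%:E = \int[P]_w (f w)%:E * \int[P]_w (g w)%:E)%E.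
Proof.
move=> mf mg f0 g0 fg.
pose H (p : R * R) := (Num.max 0 p.1 * Num.max 0 p.2)%:E.
have mH : measurable_fun setT H.
  apply/measurable_EFinP; apply: measurable_funM.
    by apply: measurable_maxr => //; exact: measurable_fst.
  by apply: measurable_maxr => //; exact: measurable_snd.
have H0 p : (0 <= H p)%E by rewrite lee_fin mulr_ge0// le_max lexx.
have HE w v : H (f w, g v) = ((f w)%:E * (g v)%:E)%E.
  by rewrite /H/= !max_r.
transitivity (\int[P]_w H (f w, g w))%E.
  by apply: eq_integral => w _; rewrite HE.
rewrite (integral_independent_pair mf mg fg mH H0).
under eq_integral => w _.
  under eq_integral do rewrite HE.
  rewrite ge0_integralZl ?lee_fin//; [over|by apply/measurable_EFinP|].
  by move=> ? _; rewrite lee_fin.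
rewrite ge0_integralZr//; [by apply/measurable_EFinP| by move=> ? _; rewrite lee_fin |].
by apply: integral_ge0 => ? _; rewrite lee_fin.
Qed.

End independent_product.

Notation generated_type D X := (g_sigma_algebraType
  (\bigcup_(i in D) preimage_set_system setT (X i) measurable)).

Section generated_sigma_algebra.
Context d (T : measurableType d).
Context (I : Type) (D : set I) d' (U : measurableType d') (X : I -> T -> U).

Lemma measurable_to_generated : (forall i, D i -> measurable_fun setT (X i)) ->
  measurable_fun [set: T] (id : T -> generated_type D X).
Proof.
move=> mX.
have E : @measurable _ (generated_type D X) =
    <<s \bigcup_(i in D) preimage_set_system setT (X i) measurable >> by [].
apply: (@measurability _ _ T (generated_type D X) setT id _ E).
move=> _ [A [i Di [B mB <-]] <-].
rewrite setTI preimage_id; exact: mX.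
Qed.

Lemma measurable_on_generated i : D i ->
  measurable_fun [set: generated_type D X] (X i).
Proof.
by move=> Di _ B mB; apply: sub_sigma_algebra; exists i => //; exists B.
Qed.

End generated_sigma_algebra.

(** * Moments of the Poisson process *)
Section nat_valued.
Context (R : realType) d (T : measurableType d) (P : probability T R).
Local Open Scope ereal_scope.

Lemma integral_nat_valued (f : T -> nat) (h : nat -> \bar R) :
  measurable_fun setT f -> (forall n, 0 <= h n) ->
  \int[P]_w h (f w) = \sum_(n <oo) h n * P (f @^-1` [set n]).
Proof.
move=> mf h0.
have mpre n : measurable (f @^-1` [set n]).
  by rewrite -[X in measurable X]setTI; exact: mf.
have tr : trivIset setT (fun n => f @^-1` [set n]).
  by move=> i j _ _ [w [/= -> ->]].
have UT : \bigcup_n (f @^-1` [set n]) = setT.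
  by apply/seteqP; split => // w _; exists (f w).
have mh : measurable_fun setT (fun w => h (f w)).
  exact: (measurable_nat_index (F := fun n _ => h n)).
rewrite -[X in integral _ X]UT ge0_integral_bigcup ?UT//.
apply: eq_eseriesr => n _.
rewrite (eq_integral (cst (h n))); last by move=> w; rewrite inE/= => ->.
by rewrite integral_cst.
Qed.

End nat_valued.

Section poisson_moments.
Context (R : realType).
Local Open Scope ereal_scope.
Implicit Type r : R.

(** The recursion from which both moments follow, one factor at a time. *)
Lemma poisson_pmf_recl r n : (0 < r)%R ->
  (n.+1%:R * poisson_pmf r n.+1 = r * poisson_pmf r n)%R.
Proof.
move=> r0; rewrite /poisson_pmf r0 exprS factS natrM invfM.
have n0 : (n.+1%:R * n.+1%:R^-1 = 1 :> R)%R by rewrite mulfV ?pnatr_eq0.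
transitivity ((n.+1%:R * n.+1%:R^-1) * (r * (r ^+ n / n`!%:R * expR (- r))))%R.
  have G (a b c e x : R) : (a * (r * x * (b * c) * e) = a * b * (r * (x * c * e)))%R by ring.
  exact: G.
by rewrite n0 mul1r.
Qed.

Lemma poisson_shift r (h : nat -> R) : (0 < r)%R -> (forall n, 0 <= h n)%R ->
  \sum_(n <oo) (n%:R * h n)%:E * (poisson_pmf r n)%:E =
  r%:E * \sum_(n <oo) (h n.+1)%:E * (poisson_pmf r n)%:E.
Proof.
move=> r0 h0; rewrite nneseries_recl//; last first.
  by move=> n _; rewrite -EFinM lee_fin !mulr_ge0// poisson_pmf_ge0.
rewrite mul0r mul0e add0e -nneseries_addn; last first.
  by move=> n; rewrite -EFinM lee_fin !mulr_ge0// poisson_pmf_ge0.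
rewrite -nneseriesZl; last first.
  by move=> n _; rewrite -EFinM lee_fin !mulr_ge0// poisson_pmf_ge0.
apply: eq_eseriesr => n _; rewrite -!EFinM addn1; congr EFin.
by rewrite mulrAC poisson_pmf_recl// mulrAC mulrA.
Qed.

Lemma poisson_total r : (0 < r)%R -> \sum_(n <oo) (poisson_pmf r n)%:E = 1.
Proof.
move=> r0; have := probability_setT (poisson_prob r 0).
rewrite /= /poisson_prob r0 -nneseries_esumT// => n.
by rewrite lee_fin poisson_pmf_ge0.
Qed.

Lemma poisson_first_moment r : (0 < r)%R ->
  \sum_(n <oo) (n%:R)%:E * (poisson_pmf r n)%:E = r%:E.
Proof.
move=> r0; under eq_eseriesr do rewrite -[X in X%:E * _]mulr1.
rewrite (poisson_shift (h := fun=> 1%R))//.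
by under eq_eseriesr do rewrite mul1e; rewrite poisson_total// mule1.
Qed.

Lemma poisson_second_moment r : (0 < r)%R ->
  \sum_(n <oo) (n%:R ^+ 2)%:E * (poisson_pmf r n)%:E = (r + r ^+ 2)%:E.
Proof.
move=> r0; under eq_eseriesr do rewrite expr2.
rewrite (poisson_shift (h := fun n => n%:R))//.
under eq_eseriesr do rewrite -natr1 EFinD ge0_muleDl ?mul1e//.
rewrite nneseriesD ?poisson_first_moment ?poisson_total//.
- by rewrite -EFinD -EFinM mulrDr mulr1 addrC -expr2.
- by move=> n _ _; rewrite -EFinM lee_fin mulr_ge0// poisson_pmf_ge0.
- by move=> n _ _; rewrite lee_fin poisson_pmf_ge0.
Qed.

End poisson_moments.

Section levy_increments.
Context (R : realType) d (T : measurableType d) (P : probability T R).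

Lemma levy_stationary_integral (X : R -> T -> R) (s t : R) (f : R -> \bar R) :
  levy_process P X -> 0 <= s -> 0 <= t -> measurable_fun setT f ->
  (forall x, (0 <= f x)%E) ->
  (\int[P]_w f (X (s + t) w - X s w)%R = \int[P]_w f (X t w))%E.
Proof.
move=> LX s0 t0 mf f0; have mX := levy_measurable LX.
have mI : measurable_fun setT (fun w => X (s + t) w - X s w).
  by apply: measurable_funB; apply: mX => //; exact: addr_ge0.
pose F : {RV P >-> R} := HB.pack (fun w => X (s + t) w - X s w)
  (isMeasurableFun.Build _ _ _ _ _ mI).
pose G : {RV P >-> R} := HB.pack (X t) (isMeasurableFun.Build _ _ _ _ _ (mX t t0)).
transitivity (\int[distribution P F]_x f x)%E.
  by rewrite ge0_integral_distribution.
transitivity (\int[distribution P G]_x f x)%E; last by rewrite ge0_integral_distribution.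
apply: eq_measure_integral => A mA _; exact: levy_stationary LX _ _ _ _ _ _.
Qed.

End levy_increments.

Section poisson_process.
Context (R : realType) d (T : measurableType d) (P : probability T R).
Context (mu : R) (N : R -> T -> nat).
Hypothesis mu0 : 0 < mu.
Hypothesis PN : poisson_process P mu N.
Let LN := poisson_levy PN.

Lemma measurable_poisson_real t : 0 <= t -> measurable_fun setT (fun w => (N t w)%:R : R).
Proof. by move=> t0; exact: (levy_measurable LN t0). Qed.

Lemma measurable_poisson t : 0 <= t -> measurable_fun setT (N t).
Proof. by move=> t0; exact: measurable_of_natr (measurable_poisson_real t0). Qed.

Lemma poisson_start : {ae P, forall w, N 0 w = 0%N}.
Proof.
by apply: filterS (levy_start LN) => w /eqP; rewrite pnatr_eq0 => /eqP.
Qed.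

Local Open Scope ereal_scope.

Lemma integral_poisson (t : R) : (0 <= t)%R -> \int[P]_w ((N t w)%:R)%:E = (mu * t)%:E.
Proof.
rewrite le_eqVlt => /predU1P[<-|t0].
  rewrite mulr0; rewrite (ae_eq_integral (cst 0))//; first by rewrite integral0.
    by apply/measurable_EFinP; exact: measurable_poisson_real.
  by apply: filterS poisson_start => w ->.
rewrite (@integral_nat_valued _ _ _ P (N t) (fun n => (n%:R)%:E))//; last first.
  by apply: measurable_poisson; exact: ltW.
by under eq_eseriesr do rewrite (poisson_law PN)//; rewrite poisson_first_moment ?mulr_gt0.
Qed.

Lemma integral_poisson_square (t : R) : (0 <= t)%R ->
  \int[P]_w ((N t w)%:R ^+ 2)%:E = (mu * t + (mu * t) ^+ 2)%:E.
Proof.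
rewrite le_eqVlt => /predU1P[<-|t0].
  rewrite mulr0 expr0n/= addr0; rewrite (ae_eq_integral (cst 0))//; first by rewrite integral0.
    by apply/measurable_EFinP; apply: measurable_funX; exact: measurable_poisson_real.
  by apply: filterS poisson_start => w -> _ /=; rewrite expr0n.
rewrite (@integral_nat_valued _ _ _ P (N t) (fun n => (n%:R ^+ 2)%:E))//; last first.
  by apply: measurable_poisson; exact: ltW.
by under eq_eseriesr do rewrite (poisson_law PN)//; rewrite poisson_second_moment ?mulr_gt0.
Qed.

Lemma poisson_mono (u v : R) : (0 <= u)%R -> (u <= v)%R ->
  {ae P, forall w, (N u w <= N v w)%N}.
Proof.
move=> u0 uv; have vu0 : (0 <= v - u)%R by rewrite subr_ge0.
have mI : measurable_fun setT (fun w => (N v w)%:R - (N u w)%:R : R)%R.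
  by apply: measurable_funB; apply: measurable_poisson_real => //; exact: le_trans uv.
have := levy_stationary LN u0 vu0 (@measurable_itv R `]-oo, 0%R[).
rewrite subrKC (_ : (fun w => (N (v - u) w)%:R)%R @^-1` _ = set0); last first.
  by apply/seteqP; split => // w /=; rewrite in_itv/= ltNge ler0n.
rewrite measure0 => /ae_null H.
apply: filterS (H _) => [w|].
  by rewrite /= in_itv/= subr_lt0 ltr_nat => /negP; rewrite -leqNgt.
by rewrite -[X in measurable X]setTI; exact: mI.
Qed.

(** Polarization: 2 N_u N_v = N_u^2 + N_v^2 - (N_v - N_u)^2, and by stationarity
    the last square has the mean of N_(v-u)^2.  The identity is used in its
    subtraction-free form, with integrals that may a priori be infinite. *)
Lemma integral_poisson_prod (u v : R) : (0 <= u)%R -> (u <= v)%R ->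
  \int[P]_w ((N u w)%:R * (N v w)%:R)%:E = (mu * u + mu ^+ 2 * (u * v))%:E.
Proof.
move=> u0 uv; have vu0 : (0 <= v - u)%R by rewrite subr_ge0.
have v0 := le_trans u0 uv.
have mu_ := measurable_poisson_real u0; have mv_ := measurable_poisson_real v0.
have SI := levy_stationary_integral LN u0 vu0 (f := fun x => (x ^+ 2)%:E).
have {}SI : \int[P]_w (((N v w)%:R - (N u w)%:R) ^+ 2)%:E =
    (mu * (v - u) + (mu * (v - u)) ^+ 2)%:E.
  rewrite -integral_poisson_square// -SI ?subrKC//.
    by apply/measurable_EFinP; exact: measurable_funX.
  by move=> x; rewrite lee_fin sqr_ge0.
have E : \int[P]_w (2 * ((N u w)%:R * (N v w)%:R))%:E +
         \int[P]_w (((N v w)%:R - (N u w)%:R) ^+ 2)%:E =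
         \int[P]_w ((N u w)%:R ^+ 2)%:E + \int[P]_w ((N v w)%:R ^+ 2)%:E.
  have sq (f : T -> R) : measurable_fun setT f ->
      measurable_fun setT (fun w => (f w ^+ 2)%:E).
    by move=> ?; apply/measurable_EFinP; exact: measurable_funX.
  have sq0 (f : T -> R) w : setT w -> 0 <= (f w ^+ 2)%:E by rewrite lee_fin sqr_ge0.
  rewrite -!ge0_integralD//=; try by [apply: sq => //; exact: measurable_funB|exact: sq0].
  - by apply: eq_integral => w _; rewrite -!EFinD; congr EFin; ring.
  - by apply/measurable_EFinP; do 2 apply: measurable_funM => //.
move: E; rewrite SI !integral_poisson_square//.
under eq_integral do rewrite EFinM.
rewrite ge0_integralZl//; last by apply/measurable_EFinP; exact: measurable_funM.
have : 0 <= \int[P]_w ((N u w)%:R * (N v w)%:R)%:E.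
  by apply: integral_ge0 => w _; rewrite lee_fin mulr_ge0.
case: (\int[P]_w _) => [x| |]//= x0.
- by rewrite -EFinM -!EFinD => -[E]; congr EFin; lra.
- by rewrite mulry gtr0_sg// mul1e.
Qed.

End poisson_process.

(** * Moments of the generalized counting process *)
Section jumps.
Context (R : realType) d (T : measurableType d) (P : probability T R).
Context (k : nat) (lam : 'I_k -> R) (X : nat -> T -> nat).
Hypothesis k1 : (1 <= k)%N.
Hypothesis lam0 : forall j, 0 < lam j.
Hypothesis JX : jump_sizes P lam X.
Let mX := jump_measurable JX.

(** The index [j] stands for the jump size [j.+1]. *)
Definition jump_moment (n : nat) : R :=
  \sum_(j < k) (j.+1%:R ^+ n) * (lam j / \sum_(l < k) lam l).

Lemma total_rate_gt0 : 0 < \sum_(l < k) lam l.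
Proof.
case: k k1 lam lam0 => // k' _ l l0.
by rewrite big_ord_recl ltr_wpDr// sumr_ge0// => i _; exact: ltW.
Qed.

Lemma jump_moment0 : jump_moment 0 = 1.
Proof.
rewrite /jump_moment; under eq_bigr do rewrite expr0 mul1r.
by rewrite -mulr_suml mulfV// gt_eqF// total_rate_gt0.
Qed.

Lemma jump_weight_ge0 j : 0 <= lam j / \sum_(l < k) lam l.
Proof. by rewrite divr_ge0// ltW// total_rate_gt0. Qed.

Lemma jump_moment_ge0 n : 0 <= jump_moment n.
Proof. by rewrite sumr_ge0// => j _; rewrite mulr_ge0// jump_weight_ge0. Qed.

Lemma jump_moment_ge1 n : 1 <= jump_moment n.
Proof.
rewrite -jump_moment0 ler_sum// => j _; rewrite expr0 ler_wpM2r ?jump_weight_ge0//.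
by rewrite exprn_ege1// ler1n.
Qed.

(** The difference is the variance of the jump distribution. *)
Lemma jump_variance_ge0 : jump_moment 1 ^+ 2 <= jump_moment 2.
Proof.
rewrite -subr_ge0.
have -> : jump_moment 2 - jump_moment 1 ^+ 2 =
    \sum_(j < k) (j.+1%:R - jump_moment 1) ^+ 2 * (lam j / \sum_(l < k) lam l).
  set m := jump_moment 1; pose q j := lam j / \sum_(l < k) lam l.
  rewrite (eq_bigr (fun j : 'I_k => j.+1%:R ^+ 2 * q j -
    (2 * m) * (j.+1%:R * q j) + m ^+ 2 * q j)).
    have E0 : \sum_(j < k) q j = 1.
      by rewrite -jump_moment0; apply: eq_bigr => j _; rewrite mul1r.
    have E1 : \sum_(j < k) j.+1%:R * q j = m by [].
    by rewrite big_split/= sumrB -!mulr_sumr E0 E1 -/(jump_moment 2); ring.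
  by move=> j _; rewrite -/(q j); ring.
by rewrite sumr_ge0// => j _; rewrite mulr_ge0 ?sqr_ge0// jump_weight_ge0.
Qed.

Lemma measurable_jump_pre i n : measurable (X i @^-1` [set n]).
Proof. by rewrite -[Y in measurable Y]setTI; exact: mX. Qed.

Lemma measurable_jump_real i : measurable_fun setT (fun w => (X i w)%:R : R).
Proof. exact: (measurableT_comp (f := fun n : nat => n%:R : R)). Qed.

(** The prescribed probabilities already add up to 1. *)
Lemma jump_range i : {ae P, forall w, exists j : 'I_k, X i w = j.+1}.
Proof.
pose A := \big[setU/set0]_(j < k) (X i @^-1` [set j.+1]).
have mA : measurable A by apply: bigsetU_measurable => j _; exact: measurable_jump_pre.
have PA : P A = 1%E.
  rewrite (measure_bigsetU P (F := fun j : nat => X i @^-1` [set j.+1]))//=.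
  - rewrite (eq_bigr (fun j : 'I_k => (lam j / \sum_(l < k) lam l)%:E)); last first.
      by move=> j _; rewrite (jump_law JX).
    by rewrite sumEFin -mulr_suml mulfV// gt_eqF// total_rate_gt0.
  - by move=> j; exact: measurable_jump_pre.
  - by move=> j j' _ _ [w [/= -> [jj']]].
have : P (~` A) = 0%E by rewrite probability_setC// PA subee.
move=> /ae_null H; apply: filterS (H (measurableC mA)) => w /contrapT.
by rewrite /A -(bigcup_mkord k (fun j => X i @^-1` [set j.+1])) => -[j /= jk ->]; exists (Ordinal jk).
Qed.

Lemma integral_jump i n : (\int[P]_w ((X i w)%:R ^+ n)%:E = (jump_moment n)%:E)%E.
Proof.
have mF (j : nat) : measurable_fun setT (fun w => (j.+1%:R ^+ n * \1_(X i @^-1` [set j.+1]) w : R)).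
  by apply: measurable_funM => //; apply: measurable_indic; exact: measurable_jump_pre.
transitivity (\int[P]_w \sum_(j < k) (j.+1%:R ^+ n * \1_(X i @^-1` [set j.+1]) w)%:E)%E.
  apply: ae_eq_integral => //.
  - by apply/measurable_EFinP; apply: measurable_funX; exact: measurable_jump_real.
  - by apply: emeasurable_sum => j; apply/measurable_EFinP.
  apply: filterS (jump_range i) => w [j wj] _.
  rewrite (bigD1 j)//= big1 ?adde0.
    by rewrite indicE mem_set ?mulr1 ?wj.
  move=> j' jj'; rewrite indicE memNset ?mulr0//= wj => -[] /val_inj /esym /eqP.
  by rewrite (negbTE jj').
rewrite ge0_integral_sum//=; last by move=> j; apply/measurable_EFinP.
rewrite /jump_moment -sumEFin; apply: eq_bigr => j _.
under eq_integral do rewrite EFinM.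
rewrite ge0_integralZl ?lee_fin//; last first.
  by apply/measurable_EFinP; apply: measurable_indic; exact: measurable_jump_pre.
rewrite integral_indic//; last exact: measurable_jump_pre.
rewrite EFinM -(jump_law JX i j); congr (_ * P _)%E; exact: setIT.
Qed.

Lemma integral_jump_prod i j : (\int[P]_w ((X i w)%:R * (X j w)%:R)%:E =
  (if i == j then jump_moment 2 else jump_moment 1 ^+ 2)%:E)%E.
Proof.
case: eqVneq => [->|ij].
  by rewrite -(integral_jump j); apply: eq_integral => w _; rewrite expr2.
rewrite (integral_independent_prod (f := fun w => (X i w)%:R) (g := fun w => (X j w)%:R))//;
  try exact: measurable_jump_real.
  under eq_integral do rewrite -[X in X%:E]expr1.
  rewrite integral_jump; under eq_integral do rewrite -[X in X%:E]expr1.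
  by rewrite integral_jump -EFinM expr2.
move=> A B mA mB.
exact: (mutually_independent_pair (A := (fun n : nat => n%:R) @^-1` A)
  (B := (fun n : nat => n%:R) @^-1` B) (jump_independent JX)).
Qed.

Definition jump_total n w : R := \sum_(i < n) (X i w)%:R.

Lemma measurable_jump_total n : measurable_fun setT (jump_total n).
Proof. by apply: measurable_sum => i; exact: measurable_jump_real. Qed.

Lemma jump_total_ge0 n w : 0 <= jump_total n w.
Proof. by rewrite sumr_ge0. Qed.

Lemma integral_jump_total n : (\int[P]_w (jump_total n w)%:E = (n%:R * jump_moment 1)%:E)%E.
Proof.
rewrite /jump_total; under eq_integral do rewrite -sumEFin.
rewrite ge0_integral_sum//=; last first.
  by move=> j; apply/measurable_EFinP; exact: measurable_jump_real.
rewrite (eq_bigr (fun=> (jump_moment 1)%:E)) => [|i _].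
  by rewrite sumEFin sumr_const card_ord mulr_natl.
by rewrite -(integral_jump i); apply: eq_integral => w _; rewrite expr1.
Qed.

(** Of the n l pairs of jumps, n are diagonal and the others independent. *)
Lemma integral_jump_total_prod n l : (n <= l)%N ->
  (\int[P]_w (jump_total n w * jump_total l w)%:E =
  (n%:R * (jump_moment 2 - jump_moment 1 ^+ 2) + n%:R * l%:R * jump_moment 1 ^+ 2)%:E)%E.
Proof.
move=> nl.
transitivity (\int[P]_w \sum_(i < n) \sum_(j < l) ((X i w)%:R * (X j w)%:R)%:E)%E.
  apply: eq_integral => w _; rewrite /jump_total mulr_suml -sumEFin.
  by apply: eq_bigr => i _; rewrite mulr_sumr sumEFin.
have mXX (i j : nat) : measurable_fun setT (fun w => ((X i w)%:R * (X j w)%:R)%:E : \bar R).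
  by apply/measurable_EFinP; apply: measurable_funM; exact: measurable_jump_real.
have XX0 (i j : nat) w : (0 <= ((X i w)%:R * (X j w)%:R)%:E :> \bar R)%E.
  by rewrite lee_fin mulr_ge0.
rewrite ge0_integral_sum//=; last 2 first.
- by move=> i; exact: emeasurable_sum.
- by move=> i w _; apply: sume_ge0.
transitivity (\sum_(i < n) (jump_moment 2 - jump_moment 1 ^+ 2 + l%:R * jump_moment 1 ^+ 2)%:E)%E.
  apply: eq_bigr => i _; rewrite ge0_integral_sum//=.
  rewrite (eq_bigr (fun j : 'I_l => ((jump_moment 2 - jump_moment 1 ^+ 2) * (i == j :> nat)%:R
    + jump_moment 1 ^+ 2)%:E)) => [|j _].
    rewrite sumEFin big_split/= sumr_const card_ord mulr_natl -mulr_sumr.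
    congr (_ + _)%:E; rewrite (bigD1 (widen_ord nl i))//= eqxx big1 ?addr0 ?mulr1//.
    by move=> j /eqP ji; case: eqP => // ij; case: ji; exact/val_inj.
  by rewrite integral_jump_prod; case: eqP => _; congr EFin; rewrite ?mulr1 ?mulr0 ?add0r// subrK.
by rewrite sumEFin sumr_const card_ord -[X in X%:E]mulr_natl mulrDr mulrA.
Qed.

End jumps.

Section compound_poisson.
Context (R : realType) d (T : measurableType d) (P : probability T R).
Context (k : nat) (lam : 'I_k -> R) (M : R -> T -> nat).
Hypothesis k1 : (1 <= k)%N.
Hypothesis lam0 : forall j, 0 < lam j.
Hypothesis GM : generalized_counting_process P lam M.
Let rate := \sum_(j < k) lam j.
Let rate_gt0 : 0 < rate. Proof. exact: total_rate_gt0. Qed.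

(** The moments of the Levy measure of the process. *)
Definition gcp_moment (n : nat) : R := jump_moment lam n * \sum_(j < k) lam j.

Lemma gcp_moment_gt0 n : 0 < gcp_moment n.
Proof. by rewrite mulr_gt0// (lt_le_trans ltr01)// jump_moment_ge1. Qed.

Lemma gcp_jump_totalE (N : R -> T -> nat) (X : nat -> T -> nat) t w :
  (forall (t : R) w, 0 <= t -> M t w = (\sum_(i < N t w) X i w)%N) -> 0 <= t ->
  (M t w)%:R = jump_total R X (N t w) w.
Proof. by move=> ME t0; rewrite ME// natr_sum. Qed.

Lemma measurable_gcp t : 0 <= t -> measurable_fun setT (fun w => (M t w)%:R : R).
Proof.
have [N [X [PN JX _ ME]]] := GM => t0.
rewrite (_ : (fun w => _) = (fun w => jump_total R X (N t w) w)); last first.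
  by apply/funext => w; exact: gcp_jump_totalE ME t0.
apply: (measurable_nat_index (F := fun n => jump_total R X n)).
  exact: measurable_poisson PN _ t0.
by move=> n; exact: measurable_jump_total JX _.
Qed.

(** An integer-valued right-continuous function is locally constant to the
    right. *)
Lemma gcp_right_continuous w t : 0 <= t ->
  (M x w)%:R @[x --> t^'+] --> ((M t w)%:R : R).
Proof.
have [N [X [PN JX _ ME]]] := GM => t0.
have [rc _] := levy_cadlag (poisson_levy PN) w t0.
apply: cvg_near_cst.
have := rc; move=> /cvgrPdist_lt /(_ _ ltr01) H.
near=> x.
have tx : t < x by near: x; exact: nbhs_right_gt.
have : `|(N t w)%:R - (N x w)%:R : R| < 1 by near: x.
move=> NN; have E : N t w = N x w.
  move: NN; rewrite ltr_norml => /andP[N1 N2].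
  case: (ltngtP (N t w) (N x w)) => //; rewrite -(ler_nat R) -natr1 => ?; exfalso; lra.
by rewrite !ME ?E// (le_trans t0)// ltW.
Unshelve. all: by end_near. Qed.

Section expand.
Context (N : R -> T -> nat) (X : nat -> T -> nat).
Hypothesis PN : poisson_process P rate N.
Hypothesis JX : jump_sizes P lam X.
Hypothesis NX : independent_systems P (generated_by (@nonneg_times R) N)
                              (generated_by [set: nat] X).
Local Notation TN := (generated_type (@nonneg_times R) N).
Local Notation TX := (generated_type [set: nat] X).

Let mN : measurable_fun [set: T] (id : T -> TN).
Proof. by apply: measurable_to_generated => t; exact: measurable_poisson PN _. Qed.

Let mX : measurable_fun [set: T] (id : T -> TX).
Proof. by apply: measurable_to_generated => i _; exact: jump_measurable JX i. Qed.

Let indep (A : set TN) (B : set TX) : measurable A -> measurable B ->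
  P ((id : T -> TN) @^-1` A `&` (id : T -> TX) @^-1` B) =
  (P ((id : T -> TN) @^-1` A) * P ((id : T -> TX) @^-1` B))%E.
Proof. by move=> mA mB; exact: NX. Qed.

Let measurable_index (t : R) : 0 <= t ->
  measurable_fun [set: (TN * TX)%type] (fun p => jump_total R X (N t p.1) p.2).
Proof.
move=> t0.
apply: (measurable_nat_index (f := fun p : TN * TX => N t p.1)
  (F := fun n (p : TN * TX) => jump_total R X n p.2)).
  by apply: measurableT_comp measurable_fst; exact: measurable_on_generated.
move=> n; apply: measurable_sum => i.
apply: (measurableT_comp (f := fun n : nat => n%:R : R)) => //.
by apply: measurableT_comp measurable_snd; exact: measurable_on_generated.
Qed.

Let expand1 (t : R) : 0 <= t ->
  (\int[P]_w (jump_total R X (N t w) w)%:E =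
   \int[P]_w \int[P]_v (jump_total R X (N t w) v)%:E)%E.
Proof.
move=> t0; apply: (integral_independent_pair mN mX indep
  (H := fun p => (jump_total R X (N t p.1) p.2)%:E)).
  by apply/measurable_EFinP; exact: measurable_index.
by move=> p; rewrite lee_fin jump_total_ge0.
Qed.

Let expand2 (t u : R) : 0 <= t -> 0 <= u ->
  (\int[P]_w (jump_total R X (N t w) w * jump_total R X (N u w) w)%:E =
   \int[P]_w \int[P]_v (jump_total R X (N t w) v * jump_total R X (N u w) v)%:E)%E.
Proof.
move=> t0 u0; apply: (integral_independent_pair mN mX indep
  (H := fun p => (jump_total R X (N t p.1) p.2 * jump_total R X (N u p.1) p.2)%:E)).
  by apply/measurable_EFinP; apply: measurable_funM; exact: measurable_index.
by move=> p; rewrite lee_fin mulr_ge0// jump_total_ge0.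
Qed.

Lemma integral_compound (t : R) : 0 <= t ->
  (\int[P]_w (jump_total R X (N t w) w)%:E = (gcp_moment 1 * t)%:E)%E.
Proof.
move=> t0; rewrite expand1//.
under eq_integral do rewrite (integral_jump_total k1 lam0 JX) mulrC EFinM.
rewrite ge0_integralZl//; last 2 first.
- by apply/measurable_EFinP; exact: measurable_poisson_real PN _ t0.
- by rewrite lee_fin jump_moment_ge0.
by rewrite (integral_poisson rate_gt0 PN)// -EFinM mulrA.
Qed.

(** With m1, m2 the moments of a jump, the conditional expectation given N is
    N_u (m2 - m1^2) + N_u N_v m1^2 where N_u <= N_v, that is, almost surely; the
    Poisson moments conclude. *)
Lemma integral_compound_prod (u v : R) : 0 <= u -> u <= v ->
  (\int[P]_w (jump_total R X (N u w) w * jump_total R X (N v w) w)%:E =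
   (gcp_moment 2 * u + gcp_moment 1 ^+ 2 * (u * v))%:E)%E.
Proof.
move=> u0 uv; have v0 := le_trans u0 uv; rewrite expand2//.
set m1 := jump_moment lam 1; set m2 := jump_moment lam 2.
have mNu := measurable_poisson_real PN u0; have mNv := measurable_poisson_real PN v0.
have m12 : 0 <= m2 - m1 ^+ 2 by rewrite subr_ge0 jump_variance_ge0.
have mf : measurable_fun setT (fun w => (m2 - m1 ^+ 2) * (N u w)%:R : R).
  exact: measurable_funM.
have mg : measurable_fun setT (fun w => m1 ^+ 2 * ((N u w)%:R * (N v w)%:R) : R).
  by apply: measurable_funM => //; exact: measurable_funM.
transitivity (\int[P]_w (((m2 - m1 ^+ 2) * (N u w)%:R)%:E +
    (m1 ^+ 2 * ((N u w)%:R * (N v w)%:R))%:E))%E.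
  apply: ae_eq_integral => //.
  - apply: (measurable_independent_section P mN mX (H := fun p : TN * TX =>
      (jump_total R X (N u p.1) p.2 * jump_total R X (N v p.1) p.2)%:E)).
      by apply/measurable_EFinP; apply: measurable_funM; exact: measurable_index.
    by move=> p; rewrite lee_fin mulr_ge0// jump_total_ge0.
  - by apply: emeasurable_funD; exact/measurable_EFinP.
  - apply: filterS (poisson_mono PN u0 uv) => w Nuv _.
    rewrite (integral_jump_total_prod k1 lam0 JX Nuv) -EFinD; congr EFin.
    by rewrite -/m1 -/m2; ring.
rewrite ge0_integralD//; last 4 first.
- by move=> w _; rewrite lee_fin mulr_ge0.
- exact/measurable_EFinP.
- by move=> w _; rewrite lee_fin mulr_ge0 ?sqr_ge0// mulr_ge0.
- exact/measurable_EFinP.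
under eq_integral do rewrite EFinM.
under [X in (_ + X)%E]eq_integral do rewrite EFinM.
rewrite !ge0_integralZl ?lee_fin ?sqr_ge0//; last 2 first.
- by apply/measurable_EFinP; exact: measurable_funM.
- exact/measurable_EFinP.
rewrite (integral_poisson rate_gt0 PN)// (integral_poisson_prod rate_gt0 PN)//.
rewrite -!EFinM -EFinD; congr EFin; rewrite /gcp_moment -/rate -/m1 -/m2.
by ring.
Qed.

End expand.

Lemma integral_gcp (t : R) : 0 <= t ->
  (\int[P]_w ((M t w)%:R)%:E = (gcp_moment 1 * t)%:E)%E.
Proof.
have [N [X [PN JX NX ME]]] := GM => t0.
rewrite -(integral_compound PN JX NX t0).
by apply: eq_integral => w _; rewrite (gcp_jump_totalE _ ME).
Qed.

Lemma integral_gcp_prod (u v : R) : 0 <= u -> u <= v ->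
  (\int[P]_w ((M u w)%:R * (M v w)%:R)%:E =
   (gcp_moment 2 * u + gcp_moment 1 ^+ 2 * (u * v))%:E)%E.
Proof.
have [N [X [PN JX NX ME]]] := GM => u0 uv.
rewrite -(integral_compound_prod PN JX NX u0 uv).
by apply: eq_integral => w _; rewrite !(gcp_jump_totalE _ ME)// (le_trans u0).
Qed.

End compound_poisson.

(** * Covariances of the time-changed process *)
Section square_integrable.
Context (R : realType) d (T : measurableType d) (P : probability T R).
Local Open Scope ereal_scope.

Lemma Lfun2P (f : T -> R) : measurable_fun setT f ->
  \int[P]_w (f w ^+ 2)%:E < +oo -> f \in Lfun P 2%:E.
Proof.
move=> mf f2; rewrite inE; apply/andP; split; rewrite inE/=//.
rewrite /finite_norm unlock /Lnorm poweR_lty//.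
rewrite (eq_integral (fun w => (f w ^+ 2)%:E))// => w _.
by rewrite /= powR_mulrn// real_normK// num_real.
Qed.

Lemma covariance_expand (f g : T -> R) : f \in Lfun P 2%:E -> g \in Lfun P 2%:E ->
  covariance P f g = \int[P]_w (f w * g w)%:E - \int[P]_w (f w)%:E * \int[P]_w (g w)%:E.
Proof.
move=> f2 g2; have Pfin : P setT \is a fin_num := fin_num_measure P _ measurableT.
rewrite covarianceE ?Lfun2_mul_Lfun1 ?(Lfun_subset12 Pfin)//.
by rewrite unlock.
Qed.

End square_integrable.

Section time_change.
Context (R : realType) d (T : measurableType d) (P : probability T R).
Context (alpha : R) (D : R -> T -> R) (Y : R -> T -> R).
Context (k : nat) (lam : 'I_k -> R) (M : R -> T -> nat) (Malpha : R -> T -> nat).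
Hypothesis alpha01 : 0 < alpha < 1.
Hypothesis k1 : (1 <= k)%N.
Hypothesis lam0 : forall j, 0 < lam j.
Hypothesis SD : stable_subordinator P alpha D.
Hypothesis GM : generalized_counting_process P lam M.
Hypothesis YE : forall t w, 0 <= t -> Y t w = passage D t w.
Hypothesis MY : independent_systems P (generated_by (@nonneg_times R) M)
                                      (generated_by (@nonneg_times R) Y).
Hypothesis ME : forall t w, 0 <= t -> Malpha t w = M (Y t w) w.
Local Notation m1 := (gcp_moment lam 1).
Local Notation m2 := (gcp_moment lam 2).
Local Notation TM := (generated_type (@nonneg_times R) M).
Local Notation TY := (generated_type (@nonneg_times R) Y).

Let Y0 t w : 0 <= t -> 0 <= Y t w.
Proof. by move=> t0; rewrite YE// first_passage_ge0. Qed.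

Let mYt t : 0 <= t -> measurable_fun setT (Y t).
Proof.
by move=> t0; apply: eq_measurable_fun (measurable_passage SD t) => w _; rewrite YE.
Qed.

Let mM : measurable_fun [set: T] (id : T -> TM).
Proof.
apply: measurable_to_generated => t t0.
exact: measurable_of_natr (measurable_gcp GM t0).
Qed.

Let mY : measurable_fun [set: T] (id : T -> TY).
Proof. by apply: measurable_to_generated => t; exact: mYt. Qed.

Let indep (A : set TY) (B : set TM) : measurable A -> measurable B ->
  P ((id : T -> TY) @^-1` A `&` (id : T -> TM) @^-1` B) =
  (P ((id : T -> TY) @^-1` A) * P ((id : T -> TM) @^-1` B))%E.
Proof. by move=> mA mB; rewrite setIC muleC; exact: MY. Qed.

Let measurable_eval t : 0 <= t ->
  measurable_fun [set: (TY * TM)%type] (fun p => (M (Y t p.1) p.2)%:R : R).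
Proof.
move=> t0.
apply: (measurable_right_continuous_eval (T := TM) (S := (TY * TM)%type)
  (X := fun t (w : TM) => (M t w)%:R : R) (tau := fun p : TY * TM => Y t p.1)
  (g := snd)).
- move=> u u0; apply: (measurableT_comp (f := fun n : nat => n%:R : R)) => //.
  exact: measurable_on_generated.
- by move=> w u u0; exact: gcp_right_continuous GM _ _ u0.
- by move=> p; exact: Y0.
- by apply: measurableT_comp measurable_fst; exact: measurable_on_generated.
- exact: measurable_snd.
Qed.

(** The process is evaluated on the product of the two sigma-algebras, and then
    restricted to the diagonal. *)
Lemma measurable_gfcp t : 0 <= t -> measurable_fun setT (fun w => (Malpha t w)%:R : R).
Proof.
move=> t0.
have mp : measurable_fun setT (fun w : T => ((w : TY), (w : TM))).
  exact: measurable_fun_pair mY mM.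
apply: eq_measurable_fun (measurableT_comp (measurable_eval t0) mp) => w _ /=.
by rewrite ME.
Qed.

Lemma integral_gfcp t : 0 <= t ->
  (\int[P]_w ((Malpha t w)%:R)%:E = m1%:E * \int[P]_w (passage D t w)%:E)%E.
Proof.
move=> t0; under eq_integral do rewrite ME//.
rewrite (integral_independent_pair mY mM indep
  (H := fun p => ((M (Y t p.1) p.2)%:R)%:E))//; last first.
  by apply/measurable_EFinP; exact: measurable_eval.
under eq_integral do rewrite /= (integral_gcp k1 lam0 GM) ?Y0// EFinM.
rewrite ge0_integralZl//; last 3 first.
- by apply/measurable_EFinP; exact: mYt.
- by move=> w _; rewrite lee_fin Y0.
- by rewrite lee_fin ltW// gcp_moment_gt0.
by congr (_ * _)%E; apply: eq_integral => w _; rewrite YE.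
Qed.

(** Conditioning on Y: the second moments of M are taken at the times Y_s <= Y_t,
    frozen. *)
Lemma integral_gfcp_prod s t : 0 <= s -> s <= t ->
  (\int[P]_w ((Malpha s w)%:R * (Malpha t w)%:R)%:E =
   m2%:E * \int[P]_w (passage D s w)%:E +
   (m1 ^+ 2)%:E * \int[P]_w (passage D s w * passage D t w)%:E)%E.
Proof.
move=> s0 st; have t0 := le_trans s0 st.
under eq_integral do rewrite !ME//.
rewrite (integral_independent_pair mY mM indep
  (H := fun p => ((M (Y s p.1) p.2)%:R * (M (Y t p.1) p.2)%:R)%:E))//; last first.
  by apply/measurable_EFinP; apply: measurable_funM; exact: measurable_eval.
have ms := measurable_passage SD s; have mt := measurable_passage SD t.
transitivity (\int[P]_w ((m2 * passage D s w)%:E +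
    (m1 ^+ 2 * (passage D s w * passage D t w))%:E))%E.
  apply: ae_eq_integral => //.
  - apply: (measurable_independent_section P mY mM (H := fun p : TY * TM =>
      ((M (Y s p.1) p.2)%:R * (M (Y t p.1) p.2)%:R)%:E)) => //.
    by apply/measurable_EFinP; apply: measurable_funM; exact: measurable_eval.
  - apply: emeasurable_funD; apply/measurable_EFinP; first exact: measurable_funM.
    by apply: measurable_funM => //; exact: measurable_funM.
  - apply: filterS (passage_mono SD) => w Yw _.
    by rewrite /= (integral_gcp_prod k1 lam0 GM) ?Y0 ?YE// Yw.
have m20 : 0 <= m2 by rewrite ltW// gcp_moment_gt0.
rewrite ge0_integralD//; last 4 first.
- by move=> w _; rewrite lee_fin mulr_ge0// first_passage_ge0.
- by apply/measurable_EFinP; exact: measurable_funM.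
- by move=> w _; rewrite lee_fin mulr_ge0 ?sqr_ge0// mulr_ge0// first_passage_ge0.
- by apply/measurable_EFinP; apply: measurable_funM => //; exact: measurable_funM.
under eq_integral do rewrite EFinM.
under [X in (_ + X)%E]eq_integral do rewrite EFinM.
rewrite !ge0_integralZl ?lee_fin ?sqr_ge0//.
- by apply/measurable_EFinP; exact: measurable_funM.
- by move=> w _; rewrite lee_fin mulr_ge0// first_passage_ge0.
- exact/measurable_EFinP.
- by move=> w _; rewrite lee_fin first_passage_ge0.
Qed.

Lemma Lfun_passage t : 0 < t -> passage D t \in Lfun P 2%:E.
Proof.
have /andP[a0 _] := alpha01.
move=> t0; have [C C0 UC] := subordinator_potential_power SD a0.
apply: Lfun2P; first exact: measurable_passage SD t.
by have := integral_passage_square_lty UC t0.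
Qed.

(** The second moment of the process at time t is a combination of the first two
    moments of Y_t. *)
Lemma Lfun_gfcp t : 0 < t -> (fun w => (Malpha t w)%:R) \in Lfun P 2%:E.
Proof.
move=> t0; apply: Lfun2P; first exact: measurable_gfcp (ltW t0).
have [C C0 UC] := subordinator_potential_power SD (andP alpha01).1.
under eq_integral do rewrite expr2.
rewrite integral_gfcp_prod ?(ltW t0)//.
have -> := integral_passage UC t0.
under eq_integral do rewrite -expr2.
rewrite lte_add_pinfty ?ltry// lte_mul_pinfty ?lee_fin ?sqr_ge0//.
by have := integral_passage_square_lty UC t0.
Qed.

(** The two terms are the mean of the conditional covariance given Y, and the
    covariance of the conditional means. *)
Lemma gfcp_covariance s t : 0 < s -> s <= t ->
  fine (covariance P (fun w => (Malpha s w)%:R) (fun w => (Malpha t w)%:R)) =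
  m2 * fine (\int[P]_w (passage D s w)%:E)%E +
  m1 ^+ 2 * fine (covariance P (passage D s) (passage D t)).
Proof.
move=> s0 st; have t0 := lt_le_trans s0 st.
have Pfin : P setT \is a fin_num := fin_num_measure P _ measurableT.
have fin f : f \in Lfun P 2%:E -> (\int[P]_w (f w)%:E)%E \is a fin_num.
  move=> /(Lfun_subset12 Pfin) /expectation_fin_num; by rewrite unlock.
have fin2 f g : f \in Lfun P 2%:E -> g \in Lfun P 2%:E ->
    (\int[P]_w (f w * g w)%:E)%E \is a fin_num.
  by move=> f2 g2; have := expectation_fin_num (Lfun2_mul_Lfun1 f2 g2); rewrite unlock.
have Ys := Lfun_passage s0; have Yt := Lfun_passage t0.
rewrite !covariance_expand ?Lfun_gfcp// integral_gfcp_prod ?(ltW s0)//.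
rewrite !integral_gfcp ?ltW//.
move: (fin _ Ys) (fin _ Yt) (fin2 _ _ Ys Yt).
move=> /fineK <- /fineK <- /fineK <-.
rewrite -!EFinM -!EFinD/=; ring.
Qed.

End time_change.

(** * Asymptotics of the correlations *)
Section powers_at_infinity.
Context (R : realType).
Implicit Types a p e : R.

Lemma cvg_powR_pinfty p : p < 0 -> t `^ p @[t --> +oo] --> (0 : R).
Proof.
move=> p0; apply/cvgrPdist_le => e e0; near=> t.
have e1 : 0 < e `^ p^-1 by rewrite powR_gt0.
rewrite sub0r normrN ger0_norm ?powR_ge0//.
have et : e `^ p^-1 <= t by near: t; exact: nbhs_pinfty_ge (num_real _).
rewrite (le_trans (powR_antitone (ltW p0) e1 et))//.
by rewrite -powRrM mulVf ?lt_eqF// powRr1// ltW.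
Unshelve. all: by end_near. Qed.

Lemma cvg_powR_shift a p : (t + a) `^ p / t `^ p @[t --> +oo] --> (1 : R).
Proof.
have cp : {for 1%R, continuous (@powR R ^~ p)}.
  apply: differentiable_continuous; apply/derivable1_diffP.
  by apply: derivable_powR; rewrite in_itv/= ltr01.
have inv0 : t^-1 @[t --> +oo] --> (0 : R).
  apply/(gtr0_cvgV0 (f := id)) => //.
  exact: nbhs_pinfty_gt (num_real _).
have l1 : 1 + a * t^-1 @[t --> +oo] --> (1 : R).
  rewrite -[X in _ --> X]addr0 -[X in _ --> _ + X](mulr0 a).
  by apply: cvgD; [exact: cvg_cst|apply: cvgM inv0; exact: cvg_cst].
have := cvg_comp _ _ l1 cp; rewrite /= powR1.
apply: cvg_trans; apply: near_eq_cvg; near=> t => /=.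
have t0 : 0 < t by near: t; exact: nbhs_pinfty_gt (num_real _).
have ta : 0 < t + a.
  by rewrite -ltrBlDr sub0r; near: t; exact: nbhs_pinfty_gt (num_real _).
have -> : t + a = (1 + a / t) * t by rewrite mulrDl mul1r divfK// gt_eqF.
have at0 : 0 <= 1 + a / t.
  have -> : 1 + a / t = (t + a) / t by rewrite mulrDl divff ?gt_eqF.
  by rewrite divr_ge0// ltW.
by rewrite powRM// ?ltW// mulfK// gt_eqF// powR_gt0.
Unshelve. all: by end_near. Qed.

Lemma squeeze_powR_shift p a b G (f : R -> R) :
  (\forall t \near +oo, G * (t + a) `^ p <= f t <= G * (t + b) `^ p) ->
  f t / t `^ p @[t --> +oo] --> G.
Proof.
move=> fG.
have lim c : G * ((t + c) `^ p / t `^ p) @[t --> +oo] --> G.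
  rewrite -[X in _ --> X]mulr1; apply: cvgM; first exact: cvg_cst.
  exact: cvg_powR_shift.
apply: squeeze_cvgr (lim a) (lim b); near=> t.
have t0 : 0 < t `^ p.
  by rewrite powR_gt0//; near: t; exact: nbhs_pinfty_gt (num_real _).
have /andP[f1 f2] : G * (t + a) `^ p <= f t <= G * (t + b) `^ p by near: t.
by rewrite !mulrA !ler_wpM2r// invr_ge0 ltW.
Unshelve. all: by end_near. Qed.

(** The powers combine to (alpha - 2) - (alpha - 1) / 2 = - (3 - alpha) / 2; the
    variance at the fixed time enters as a constant. *)
Lemma correlation_asymptotic (alpha G V Vs : R) (cov var : R -> R) :
  0 < V -> 0 < Vs -> 0 < G ->
  cov t / t `^ (alpha - 2) @[t --> +oo] --> G ->
  var t / t `^ (alpha - 1) @[t --> +oo] --> V ->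
  asymptotic_to (fun t => cov t / (Num.sqrt Vs * Num.sqrt (var t)))
    (fun t => G / (Num.sqrt Vs * Num.sqrt V) * t `^ (- ((3 - alpha) / 2))).
Proof.
move=> V0 Vs0 G0 covG varV; rewrite /asymptotic_to.
have sV0 : Num.sqrt V != 0 by rewrite gt_eqF// sqrtr_gt0.
have sVs0 : Num.sqrt Vs != 0 by rewrite gt_eqF// sqrtr_gt0.
have lim : (cov t / t `^ (alpha - 2)) / Num.sqrt (var t / t `^ (alpha - 1)) *
    (Num.sqrt V / G) @[t --> +oo] --> (1 : R).
  rewrite [X in _ --> X](_ : _ = G / Num.sqrt V * (Num.sqrt V / G)); last first.
    by rewrite mulrA divfK// divff// gt_eqF.
  apply: cvgM; last exact: cvg_cst.
  apply: cvgM covG _; apply: cvgV => //.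
  by apply: cvg_comp varV _; exact: sqrt_continuous.
apply: cvg_trans lim; apply: near_eq_cvg; near=> t.
have t0 : 0 < t by near: t; exact: nbhs_pinfty_gt (num_real _).
have ta0 : 0 < t `^ (alpha - 1) by rewrite powR_gt0.
have v0 : 0 < var t / t `^ (alpha - 1) by near: t; exact: (cvgr_gt V).
have var0 : 0 < var t by move: v0; rewrite pmulr_lgt0 ?invr_gt0.
have E1 : Num.sqrt (var t / t `^ (alpha - 1)) =
    Num.sqrt (var t) / t `^ ((alpha - 1) / 2).
  rewrite sqrtrM ?(ltW var0)// sqrtrV ?(ltW ta0)//.
  by rewrite -(powR12_sqrt (powR_ge0 t (alpha - 1))) -powRrM.
have E2 : t `^ (alpha - 2) = t `^ ((alpha - 1) / 2) * t `^ (- ((3 - alpha) / 2)).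
  rewrite -powRD; last by rewrite (gt_eqF t0) implybT.
  by congr (powR _ _); field.
rewrite E1 E2.
have p0 : t `^ ((alpha - 1) / 2) != 0 by rewrite gt_eqF// powR_gt0.
have q0 : t `^ (- ((3 - alpha) / 2)) != 0 by rewrite gt_eqF// powR_gt0.
have sv0 : Num.sqrt (var t) != 0 by rewrite gt_eqF// sqrtr_gt0.
have G0' : G != 0 by rewrite gt_eqF.
by field; rewrite sVs0 sv0 sV0 q0 p0 G0'.
Unshelve. all: by end_near. Qed.

End powers_at_infinity.

Section increments.
Context (R : realType) d (T : measurableType d) (P : probability T R).

Lemma fine_covariance_increments (a b x y : T -> R) :
  a \in Lfun P 2%:E -> b \in Lfun P 2%:E -> x \in Lfun P 2%:E -> y \in Lfun P 2%:E ->
  fine (covariance P (b \- a) (y \- x)) =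
  fine (covariance P b y) - fine (covariance P b x)
  - fine (covariance P a y) + fine (covariance P a x).
Proof.
move=> a2 b2 x2 y2; have Pfin : P setT \is a fin_num := fin_num_measure P _ measurableT.
have fin f g : f \in Lfun P 2%:E -> g \in Lfun P 2%:E -> covariance P f g \is a fin_num.
  move=> f2 g2.
  by rewrite covariance_fin_num ?Lfun2_mul_Lfun1 ?(Lfun_subset12 Pfin).
have yx2 : (y \- x)%R \in Lfun P 2%:E by rewrite rpredB ?lee1n.
rewrite covarianceBl// !covarianceBr//.
move: (fin _ _ b2 y2) (fin _ _ b2 x2) (fin _ _ a2 y2) (fin _ _ a2 x2).
move=> /fineK <- /fineK <- /fineK <- /fineK <-.
by rewrite -!EFinB/=; ring.
Qed.

End increments.

Section gfcp_increments.
Context (R : realType) d (T : measurableType d) (P : probability T R).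
Context (alpha : R) (D : R -> T -> R) (h : R).
Hypothesis alpha01 : 0 < alpha < 1.
Hypothesis SD : stable_subordinator P alpha D.
Hypothesis h0 : 0 < h.
Local Notation Y := (passage D).
Local Notation dY t := (Y (t + h) \- Y t).

Let th t : 0 < t -> 0 < t + h.
Proof. by move=> t0; rewrite addr_gt0. Qed.

Lemma Lfun_passage_increment t : 0 < t -> dY t \in Lfun P 2%:E.
Proof.
move=> t0; have L1 := Lfun_passage alpha01 SD t0.
have L2 := Lfun_passage alpha01 SD (th t0).
by rewrite rpredB ?lee1n.
Qed.

Section constants.
Variable C : R.
Hypothesis C0 : 0 < C.
Hypothesis UC : forall t : R, 0 < t ->
  subordinator_potential SD `]-oo, t]%classic = (C * t `^ alpha)%:E.

Lemma integral_passage_increment t : 0 < t ->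
  (\int[P]_w (dY t w)%:E = (C * ((t + h) `^ alpha - t `^ alpha))%:E)%E.
Proof.
move=> t0; have Pfin : P setT \is a fin_num := fin_num_measure P _ measurableT.
have Y1 u : 0 < u -> P.-integrable setT (EFin \o Y u).
  by move=> u0; apply/Lfun1_integrable/(Lfun_subset12 Pfin)/(Lfun_passage alpha01 SD).
rewrite /= (integralB_EFin measurableT (Y1 _ (th t0)) (Y1 _ t0)).
have -> := integral_passage UC (th t0); have -> := integral_passage UC t0.
by rewrite -EFinB mulrBr.
Qed.

Lemma passage_increment_covariance s : 0 < s -> exists2 G, 0 < G &
  forall t, s + h < t -> G * (t + h) `^ (alpha - 2) <=
    fine (covariance P (dY s) (dY t)) <= G * (t - (s + h)) `^ (alpha - 2).
Proof.
move=> s0; have [I I0 IE] := passage_cross_bounds alpha01 C0 UC s0 h0.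
exists (C * (alpha * (1 - alpha) * h) * I) => [|t sht].
  by case/andP: alpha01 => a0 a1; rewrite !mulr_gt0// subr_gt0.
have t0 : 0 < t by rewrite (lt_trans _ sht)// th.
have := IE t sht => /= -[].
rewrite covariance_expand ?Lfun_passage_increment// !integral_passage_increment//.
set E := (\int[P]_w _)%E => E1 E2.
have Efin : E \is a fin_num.
  by rewrite fin_numElt (lt_le_trans _ E1) ?ltNyr// (le_lt_trans E2)// ltry.
move: E1 E2; rewrite -(fineK Efin) -EFinM -EFinB !lee_fin /= => E1 E2.
by apply/andP; split; lra.
Qed.

Lemma passage_increment_variance : exists2 L, 0 <= L &
  forall t, 0 < t -> C * alpha * (t + h) `^ (alpha - 1) * L <=
    (fine (covariance P (dY t) (dY t)) +
      (C * ((t + h) `^ alpha - t `^ alpha)) ^+ 2) / 2 <=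
    C * alpha * t `^ (alpha - 1) * L.
Proof.
have [L L0 LE] := passage_square_bounds alpha01 C0 UC h0.
exists L => // t t0; have := LE t t0 => /= -[].
have d2 := Lfun_passage_increment t0.
rewrite covariance_expand// !integral_passage_increment//.
have -> : (\int[P]_w ((Y (t + h) w - Y t w) ^+ 2 / 2)%:E =
    (2^-1)%:E * \int[P]_w (dY t w * dY t w)%:E)%E.
  rewrite -ge0_integralZl//; last 2 first.
  - apply/measurable_EFinP; apply: measurable_funM; apply: measurable_funB;
      exact: measurable_passage SD _.
  - by move=> w _; rewrite lee_fin -expr2 sqr_ge0.
  by apply: eq_integral => w _; rewrite -EFinM /= expr2 mulrC.
have := expectation_fin_num (Lfun2_mul_Lfun1 d2 d2); rewrite unlock.
move=> /fineK <-; rewrite -!EFinM -EFinB !lee_fin/= => E1 E2.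
by rewrite -expr2 subrK; apply/andP; split; lra.
Qed.

End constants.

Context (k : nat) (lam : 'I_k -> R) (M : R -> T -> nat) (Malpha : R -> T -> nat).
Context (Y' : R -> T -> R).
Hypothesis k1 : (1 <= k)%N.
Hypothesis lam0 : forall j, 0 < lam j.
Hypothesis GM : generalized_counting_process P lam M.
Hypothesis YE : forall t w, 0 <= t -> Y' t w = passage D t w.
Hypothesis MY : independent_systems P (generated_by (@nonneg_times R) M)
                                      (generated_by (@nonneg_times R) Y').
Hypothesis ME : forall t w, 0 <= t -> Malpha t w = M (Y' t w) w.
Local Notation m1 := (gcp_moment lam 1).
Local Notation m2 := (gcp_moment lam 2).
Local Notation Z := (increment_process Malpha h).

Let LM t : 0 < t -> (fun w => (Malpha t w)%:R) \in Lfun P 2%:E.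
Proof. exact: (Lfun_gfcp alpha01 k1 lam0 SD GM YE MY ME). Qed.

Let LY t : 0 < t -> Y t \in Lfun P 2%:E.
Proof. by move=> t0; exact (Lfun_passage alpha01 SD t0). Qed.

Let covM s t : 0 < s -> s <= t ->
  fine (covariance P (fun w => (Malpha s w)%:R) (fun w => (Malpha t w)%:R)) =
  m2 * fine (\int[P]_w (Y s w)%:E)%E + m1 ^+ 2 * fine (covariance P (Y s) (Y t)).
Proof. exact: (gfcp_covariance alpha01 k1 lam0 SD GM YE MY ME). Qed.

(** Each of the four covariances between values of the process contributes the
    mean of Y at its earlier time; as s + h <= t, this time is twice s and twice
    s + h, with opposite signs. *)
Lemma gfcp_increment_covariance s t : 0 < s -> s + h <= t ->
  fine (covariance P (Z s) (Z t)) = m1 ^+ 2 * fine (covariance P (dY s) (dY t)).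
Proof.
move=> s0 sht; have sh0 := th s0; have t0 := lt_le_trans sh0 sht.
have st : s <= t by rewrite (le_trans _ sht)// lerDl ltW.
have tth : t <= t + h by rewrite lerDl ltW.
rewrite [LHS](fine_covariance_increments (LM s0) (LM sh0) (LM t0) (LM (th t0))).
rewrite fine_covariance_increments ?LY ?th//.
rewrite !covM ?(le_trans _ tth)//.
by ring.
Qed.

Lemma gfcp_increment_variance t : 0 < t ->
  fine (variance P (Z t)) =
  m2 * (fine (\int[P]_w (Y (t + h) w)%:E)%E - fine (\int[P]_w (Y t w)%:E)%E) +
  m1 ^+ 2 * fine (covariance P (dY t) (dY t)).
Proof.
move=> t0; have tth : t <= t + h by rewrite lerDl ltW.
rewrite [LHS](fine_covariance_increments (LM t0) (LM (th t0)) (LM t0) (LM (th t0))).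
rewrite [X in _ - fine X - _ + _]covarianceC.
rewrite (fine_covariance_increments (LY t0) (LY (th t0)) (LY t0) (LY (th t0))).
rewrite [covariance P (Y (t + h)) (Y t)]covarianceC.
rewrite !covM ?th//.
by ring.
Qed.

(** The variance at a fixed time is positive, as it is at least m2 times the mean
    of an increment of Y; hence the constant of the equivalence is defined and
    positive. *)
Lemma gfcp_increment_correlation_decay :
  correlation_decay P Z ((3 - alpha) / 2).
Proof.
have /andP[a0 a1] := alpha01.
have [C C0 UC] := subordinator_potential_power SD a0.
have [L L0 LE] := passage_increment_variance C0 UC.
have m10 : 0 < m1 := gcp_moment_gt0 k1 lam0 1.
have m20 : 0 < m2 := gcp_moment_gt0 k1 lam0 2.
pose var t := fine (variance P (Z t)).
pose g t := C * ((t + h) `^ alpha - t `^ alpha).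
have gE t : 0 < t ->
    fine (\int[P]_w (Y (t + h) w)%:E)%E - fine (\int[P]_w (Y t w)%:E)%E = g t.
  move=> t0; have -> := integral_passage UC t0; have -> := integral_passage UC (th t0).
  by rewrite /g mulrBr.
have varE t : 0 < t -> var t =
    m2 * g t + m1 ^+ 2 * fine (covariance P (dY t) (dY t)).
  by move=> t0; rewrite /var gfcp_increment_variance// gE.
have var_gt0 t : 0 < t -> 0 < var t.
  move=> t0; rewrite varE// ltr_wpDr//.
    by rewrite mulr_ge0 ?sqr_ge0// fine_ge0// variance_ge0.
  by rewrite mulr_gt0// /g mulr_gt0// subr_gt0 gt0_ltr_powR ?nnegrE ?ltrDl ?ltW ?th.
pose V := m2 * (C * (alpha * h)) + m1 ^+ 2 * (2 * (C * alpha * L)).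
have V0 : 0 < V.
  have CaL : 0 <= 2 * (C * alpha * L) by rewrite !mulr_ge0// ltW.
  rewrite /V; apply: ltr_wpDr; first by rewrite mulr_ge0 ?sqr_ge0.
  by apply: mulr_gt0 => //; rewrite !mulr_gt0.
have limg : g t / t `^ (alpha - 1) @[t --> +oo] --> C * (alpha * h).
  apply: (@squeeze_powR_shift _ _ h 0); near=> t.
  have t0 : 0 < t by near: t; exact: nbhs_pinfty_gt (num_real _).
  have tth : t <= t + h by rewrite lerDl ltW.
  have := powR_diff_bounds alpha01 t0 tth; rewrite addr0 [t + h - t]addrC addKr.
  move=> /andP[g1 g2]; rewrite /g -!mulrA !ler_pM2l//.
  by rewrite [h * _]mulrC [h * t `^ _]mulrC !mulrA g1.
pose S t := fine (covariance P (dY t) (dY t)) + g t ^+ 2.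
have limS : S t / t `^ (alpha - 1) @[t --> +oo] --> 2 * (C * alpha * L).
  apply: (@squeeze_powR_shift _ _ h 0); near=> t.
  have t0 : 0 < t by near: t; exact: nbhs_pinfty_gt (num_real _).
  by have /andP[S1 S2] := LE t t0; rewrite addr0 /S /g; apply/andP; split; lra.
have limV : var t / t `^ (alpha - 1) @[t --> +oo] --> V.
  have am1 : alpha - 1 < 0 by rewrite subr_lt0.
  have lim : m2 * (g t / t `^ (alpha - 1)) + m1 ^+ 2 * (S t / t `^ (alpha - 1) -
      (g t / t `^ (alpha - 1)) ^+ 2 * t `^ (alpha - 1)) @[t --> +oo] --> V.
    rewrite /V; apply: cvgD; first by apply: cvgM limg; exact: cvg_cst.
    apply: cvgM; first exact: cvg_cst.
    rewrite -[X in _ --> X]subr0; apply: cvgB limS _.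
    rewrite -[X in _ --> X](mulr0 ((C * (alpha * h)) ^+ 2)).
    by apply: cvgM; [exact: (cvgM (limg) (limg))|exact: cvg_powR_pinfty].
  apply: cvg_trans lim; apply: near_eq_cvg; near=> t.
  have t0 : 0 < t by near: t; exact: nbhs_pinfty_gt (num_real _).
  rewrite varE// /S.
  have p0 : t `^ (alpha - 1) != 0 by rewrite gt_eqF// powR_gt0.
  by field.
move=> s s0; have [G G0 GE] := passage_increment_covariance C0 UC s0.
have G0' : 0 < m1 ^+ 2 * G by rewrite mulr_gt0// exprn_gt0.
have limC : fine (covariance P (Z s) (Z t)) / t `^ (alpha - 2) @[t --> +oo] -->
    m1 ^+ 2 * G.
  apply: (@squeeze_powR_shift _ _ h (- (s + h))); near=> t.
  have st : s + h < t by near: t; exact: nbhs_pinfty_gt (num_real _).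
  rewrite gfcp_increment_covariance ?(ltW st)// -!(mulrA (m1 ^+ 2)) !ler_pM2l ?exprn_gt0//.
  exact: GE.
exists (m1 ^+ 2 * G / (Num.sqrt (var s) * Num.sqrt V)).
  by rewrite divr_gt0// mulr_gt0// sqrtr_gt0// var_gt0.
exact: correlation_asymptotic V0 (var_gt0 s s0) G0' limC limV.
Unshelve. all: by end_near. Qed.

End gfcp_increments.

Theorem theorem3p2 (R : realType) (d : measure_display) (T : measurableType d)
  (P : probability T R) (alpha : R) (k : nat) (lam : 'I_k -> R)
  (Malpha : R -> T -> nat) (h : R) :
  0 < alpha < 1 ->
  (1 <= k)%N ->
  (forall j, 0 < lam j) ->
  gfcp P alpha lam Malpha ->
  0 < h ->
  short_range_dependent P (increment_process Malpha h).
Proof.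
move=> alpha01 k1 lam0 [M [Y [GM [D SD YE] MY ME]]] h0.
exists ((3 - alpha) / 2); first by case/andP: alpha01 => a0 a1; apply/andP; split; lra.
exact: (gfcp_increment_correlation_decay alpha01 SD h0 k1 lam0 GM YE MY ME).
Qed.
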